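(* Let $\eta>0$ and let $H$ be a graph with at least one edge, chromatic number $\chi(H)=r$ (so $r\ge2$) and $h:=|H|$. Let $\sigma\in\mathbb{R}$ with $\sigma(H)\le\sigma\le h/r$, and $\omega:=(h-\sigma)/(r-1)$. Then there exists $n_0=n_0(\eta,\sigma,H)\in\mathbb{N}$ such that the following holds: if $G$ is a graph on $n\ge n_0$ vertices with degree sequence $d_1\le\dots\le d_n$ such that \[d_i\ge\left(1-\frac{\omega+\sigma}{h}\right)n+\frac{\sigma}{\omega}i\quad\text{for all }1\le i\le\frac{\omega n}{h},\] then $G$ contains an $H$-tiling covering all but at most $\eta n$ vertices.
   Context: For a graph $H$, $\sigma(H)$ denotes the smallest possible size of a colour class over all proper colourings of $H$ with $\chi(H)$ colours. An $H$-tiling in $G$ is a collection of vertex-disjoint copies of $H$ in $G$. Degree sequences list vertex degrees in non-decreasing order. *)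

(* Defs.v *)
From mathcomp Require Import all_boot all_order all_algebra.
From mathcomp Require Import reals.

Set Implicit Arguments.
Unset Strict Implicit.
Unset Printing Implicit Defensive.

Record sgraph := SGraph {
  vertex :> finType;
  edge : rel vertex;
  edge_sym : symmetric edge;
  edge_irrefl : irreflexive edge
}.

Section Colouring.
Variable H : sgraph.

Definition proper_colouring (k : nat) (f : {ffun H -> 'I_k}) : bool :=
  [forall x, forall y, edge x y ==> (f x != f y)].

Definition colourable (k : nat) : bool :=
  [exists f : {ffun H -> 'I_k}, proper_colouring f].

Lemma exists_colourable : exists k, colourable k.
Proof.
exists #|H|; apply/existsP; exists [ffun x => enum_rank x].
apply/forallP => x; apply/forallP => y; apply/implyP => xy.
rewrite !ffunE; apply: contraTneq xy => /enum_rank_inj ->.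
by rewrite edge_irrefl.
Qed.

Definition chromatic_number : nat := ex_minn exists_colourable.

Definition colour_class (k : nat) (f : {ffun H -> 'I_k}) (c : 'I_k) : {set H} :=
  [set x | f x == c].

(* sigma(H). The default value #|H| bounds the size of every colour class, so
   it does not affect the minimum; if H has no vertices, the value is 0. *)
Definition min_colour_class : nat :=
  \big[minn/#|H|]_(f : {ffun H -> 'I_chromatic_number} | proper_colouring f)
    \big[minn/#|H|]_(c < chromatic_number) #|colour_class f c|.

End Colouring.

Section DegreeSequence.
Variable G : sgraph.

Definition degree (x : G) : nat := #|[set y | edge x y]|.

Definition degree_sequence : seq nat := sort leq [seq degree x | x : G].

(* The i-th smallest degree d_i, with indices starting from 1. *)
Definition nth_degree (i : nat) : nat := nth 0 degree_sequence i.-1.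

End DegreeSequence.

Section Tiling.
Variables H G : sgraph.

(* A copy of H in G is a (not necessarily induced) subgraph of G isomorphic
   to H; it is given here by an embedding of H onto it. *)
Definition embedding (f : {ffun H -> G}) : bool :=
  injectiveb f && [forall x, forall y, edge x y ==> edge (f x) (f y)].

Definition is_tiling (T : {set {ffun H -> G}}) : bool :=
  [forall f in T, embedding f] &&
  [forall f in T, forall g in T, (f != g) ==> [disjoint codom f & codom g]].

Definition covered (T : {set {ffun H -> G}}) : {set G} :=
  \bigcup_(f in T) [set f x | x : H].

End Tiling.

(* Main.v *)
(* The degree condition passes, with a small error, to random samples of
   bounded size, so the key step concerns a fixed finite graph: it has an almost
   perfect fractional tiling with weighted r-cliques ("bottles") that put weight
   sigma on one vertex and omega on the others. One takes an optimal tiling in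
   which covering a vertex counts slightly more when its degree is low. If some
   vertex x that is not fully covered has high degree, then by induction on r its
   neighbourhood has a tiling with smaller bottles; adding x to all of them and
   mixing the result with the optimum improves it. Otherwise no local exchange
   improves the optimum, and counting the non-neighbours of the vertices of a
   maximal clique of uncovered vertices shows that little is uncovered.

   Sampling now gives, for every weight function on a large graph G, a positive
   density of bottles of nearly average weight, hence by Erdos' theorem a blow-up
   of H with large parts and nearly average weight. Choosing such blow-ups one
   after another, with weights equal to the number of earlier blow-ups that
   contain the vertex (plus one), covers almost all vertices almost equally often.
   Finally every vertex is assigned to one of the blow-ups containing it so that
   all parts of a typical blow-up receive nearly the same number of vertices. *)
Require Import Defs.
From mathcomp Require Import boolp classical_sets topology normedtype derive.
From mathcomp Require Import all_boot all_order all_algebra.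
From mathcomp Require Import reals.
From mathcomp Require Import ring lra zify.

Set Implicit Arguments.
Unset Strict Implicit.
Unset Printing Implicit Defensive.

Import Order.TTheory GRing.Theory Num.Theory.
Local Open Scope ring_scope.

(** * Linear programming *)

Section LinearProgram.
Import numFieldNormedType.Exports.
Local Open Scope classical_set_scope.

Lemma continuous_linear_form (R : realType) (I : finType) (c : I -> R) :
  continuous (fun v : 'rV[R]_#|I| => \sum_(i : I) c i * v ord0 (enum_rank i)).
Proof.
move=> v; apply: (@cvg_big _ _ +%R 0 xpredT _ _ (nbhs v)) => [|i _].
  exact: add_continuous.
by apply: cvgMl_tmp; exact: coord_continuous.
Qed.

(** The feasible set lies in a box and is cut out by closed conditions, so it is compact and the
    extreme value theorem applies. Functions on [I] are transported to row vectors, which carry the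
    topology. *)
Lemma lp_max (R : realType) (I J : finType) (a : J -> I -> R) (b : J -> R)
    (M c : I -> R) :
  let feasible (y : I -> R) := (forall i, 0 <= y i <= M i) /\
                    (forall j, \sum_i a j i * y i <= b j) in
  (exists y, feasible y) ->
  exists2 y, feasible y &
    forall y', feasible y' -> \sum_i c i * y' i <= \sum_i c i * y i.
Proof.
move=> feasible [y0 [y0M y0b]].
pose y_of (v : 'rV[R]_#|I|) i := v ord0 (enum_rank i).
pose v_of (y : I -> R) : 'rV[R]_#|I| := \row_j y (enum_val j).
have v_ofK y : y_of (v_of y) = y.
  by apply/funext => i; rewrite /y_of /v_of mxE enum_rankK.
pose A := [set v : 'rV[R]_#|I| | feasible (y_of v)].
have A0 : A !=set0 by exists (v_of y0); rewrite /A /= v_ofK.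
have cA : compact A.
  have cB : compact [set v : 'rV[R]_#|I| |
      forall i, `[0, M (enum_val i)]%classic (v ord0 i)].
    apply: (@rV_compact _ _ (fun i => `[0, M (enum_val i)]%classic)).
    by move=> i; exact: segment_compact.
  apply: (subclosed_compact _ cB).
    rewrite (_ : A = [set v : 'rV[R]_#|I| | forall i, `[0, M (enum_val i)] (v ord0 i)] `&`
       \bigcap_(j in [set: J])
          ((fun v : 'rV[R]_#|I| => \sum_i a j i * y_of v i) @^-1` [set x | x <= b j])).
      apply: closedI.
        rewrite (_ : [set v | _] = \bigcap_(i in [set: 'I_#|I|])
            ((fun v : 'rV[R]_#|I| => v ord0 i) @^-1`
               `[0, M (enum_val i)]%classic)); last first.
          by apply/seteqP; split=> v /= hv i; [move=> _|]; apply: hv.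
        apply: closed_bigI => i _; apply: closed_comp => [v _|].
          exact: coord_continuous.
        exact: interval_closed.
      apply: closed_bigI => j _; apply: closed_comp; last exact: closed_le.
      by move=> v _; exact: continuous_linear_form.
    apply/seteqP; split=> v /=.
      move=> [v1 v2]; split=> [i|j _]; last exact: v2.
      by rewrite in_itv /=; have := v1 (enum_val i); rewrite /y_of enum_valK.
    move=> [v1 v2]; split=> [i|j]; last exact: v2.
    by have := v1 (enum_rank i); rewrite in_itv /= enum_rankK.
  move=> v [v1 v2] i; rewrite /= in_itv /=.
  by have := v1 (enum_val i); rewrite /y_of enum_valK.
have [v] := compact_EVT_max A0 cA
  (continuous_subspaceT (@continuous_linear_form R I c)).
rewrite in_setE => Av vmax; exists (y_of v) => // y' fy'.
have := vmax (v_of y'); rewrite in_setE /A /= v_ofK => /(_ fy').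
by congr (_ <= _); apply: eq_bigr => i _; rewrite -[in RHS](v_ofK y').
Qed.

End LinearProgram.

(** * Fractional tilings with bottles *)

(** Only indices with [q i < 0] limit the step, and there [p i] is positive; [S] exceeds every ratio
    [|q i| / p i], so [S^-1] works for all indices at once. *)
Lemma small_step (R : realFieldType) (I : finType) (p q : I -> R) :
  (forall i, 0 <= p i) -> (forall i, q i < 0 -> 0 < p i) ->
  exists2 s, 0 < s & forall i, 0 <= p i + s * q i.
Proof.
move=> p0 qp; pose S := 1 + \sum_i `|q i| / p i.
have term0 i : 0 <= `|q i| / p i by rewrite divr_ge0.
have S1 : 1 <= S by rewrite lerDl sumr_ge0.
have S0 : 0 < S by apply: lt_le_trans S1.
exists S^-1 => [|i]; first by rewrite invr_gt0.
have [q0|q0] := ltP (q i) 0; last by rewrite addr_ge0 // mulr_ge0 // invr_ge0 ltW.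
have pi0 := qp _ q0.
rewrite -[q i]opprK -(ltr0_norm q0) mulrN subr_ge0 mulrC ler_pdivrMr // mulrC.
rewrite -ler_pdivrMr //; apply: le_trans (_ : `|q i| / p i <= S) => //.
rewrite /S (bigD1 i) //= addrCA lerDl addr_ge0 // sumr_ge0 //.
Qed.

Lemma sum_indicator_eq (R : pzRingType) (V : finType) (W : {set V}) v :
  \sum_(w in W) (v == w)%:R = (v \in W)%:R :> R.
Proof.
have [vW|vW] := boolP (v \in W).
  rewrite (bigD1 v) //= eqxx big1 ?addr0 // => w /andP[_ wv].
  by rewrite eq_sym (negbTE wv).
by rewrite big1 // => w wW; case: eqP => // vw; rewrite vw wW in vW.
Qed.

Section FractionalBottleTiling.
Variables (R : realType) (V : finType) (e : rel V).
Hypotheses (e_sym : symmetric e) (e_irr : irreflexive e).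
Variables (om sg : R).
Hypotheses (sg_gt0 : 0 < sg) (sg_le_om : sg <= om).

Let om_gt0 : 0 < om. Proof. exact: lt_le_trans sg_le_om. Qed.

(* A weighted (k+1)-clique: the first component is the vertex that carries the
   neck weight sg, the k vertices of the second one carry weight om each. *)
Definition bottle (A : {set V}) (k : nat) (T : V * {set V}) : bool :=
  [&& T.1 \in A, T.2 \subset A, [forall v in T.2, e T.1 v],
      [forall v in T.2, forall w in T.2, (v != w) ==> e v w] & #|T.2| == k].

Definition bottle_weight (T : V * {set V}) (v : V) : R :=
  sg * (v == T.1)%:R + om * (v \in T.2)%:R.

Definition coverage (y : V * {set V} -> R) (v : V) : R :=
  \sum_T bottle_weight T v * y T.

Definition fractional_tiling (A : {set V}) (k : nat) (y : V * {set V} -> R) :=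
  [/\ forall T, 0 <= y T, forall T, ~~ bottle A k T -> y T = 0
    & forall v, coverage y v <= 1].

Lemma bottleP (A : {set V}) k (T : V * {set V}) :
  reflect [/\ T.1 \in A, {subset T.2 <= A}, {in T.2, forall v, e T.1 v},
    {in T.2 &, forall v w, v != w -> e v w} & #|T.2| = k] (bottle A k T).
Proof.
apply: (iffP and5P) => [[tA /subsetP WA /forall_inP tW /forall_inP WW /eqP cW]|].
  split=> // v w vW wW; exact/implyP/(forall_inP (WW v vW)).
case=> tA WA tW WW cW; split=> //; [exact/subsetP|exact/forall_inP| |exact/eqP].
by apply/forall_inP => v vW; apply/forall_inP => w wW; apply/implyP/WW.
Qed.

Lemma bottle_neck_notin A k T : bottle A k T -> T.1 \notin T.2.
Proof. by case/bottleP => _ _ tW _ _; apply/negP => /tW; rewrite e_irr. Qed.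

(** All adjacency conditions range over [W :\ w]. This allows [x] to miss the replaced vertex [w],
    and also allows [t = w], where a wide vertex is turned into the neck. *)
Lemma bottle_exchange (A : {set V}) k t (W : {set V}) x w :
  t \in A -> {subset W :\ w <= A} -> {in W :\ w, forall v, e t v} ->
  {in W &, forall v v', v != v' -> e v v'} -> #|W| = k.+1 -> w \in W ->
  x \in A -> e t x -> {in W :\ w, forall v, e x v} ->
  bottle A k.+1 (t, x |: W :\ w).
Proof.
move=> tA WA tW WW cW wW xA tx xW; apply/bottleP; split=> //=.
- by move=> v /setU1P[->//|/WA].
- by move=> v /setU1P[->//|/tW].
- move=> v v' /setU1P[->|vW] /setU1P[->|vW']; rewrite ?eqxx // => vv'.
  + exact: xW.
  + by rewrite e_sym; exact: xW.
  + by move: vW vW' => /setD1P[_ vW] /setD1P[_ vW']; apply: WW.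
- rewrite cardsU1 (_ : x \notin W :\ w); last first.
    by apply/negP => /xW; rewrite e_irr.
  by have := cardsD1 w W; rewrite wW cW add1n => /eqP; rewrite eqSS => /eqP <-.
Qed.

Lemma indicator_exchange (W : {set V}) x w v : w \in W -> x \notin W :\ w ->
  (v \in x |: W :\ w)%:R = (v == x)%:R + (v \in W)%:R - (v == w)%:R :> R.
Proof.
move=> wW xW; rewrite !inE; have [->|vx] /= := eqVneq v x.
  by move: xW; rewrite !inE; case: eqVneq => [->|_] /=; rewrite ?wW ?addrK //
    => /negbTE ->; rewrite addr0 subr0.
by rewrite add0r; case: eqVneq => [->|_] /=; rewrite ?wW ?subrr ?subr0.
Qed.

Lemma coverage_delta S v : coverage (fun T => (T == S)%:R) v = bottle_weight S v.
Proof.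
rewrite /coverage (bigD1 S) //= eqxx mulr1 big1 ?addr0 // => T /negbTE ->.
by rewrite mulr0.
Qed.

Lemma coverageD y z v :
  coverage (fun T => y T + z T) v = coverage y v + coverage z v.
Proof. by rewrite -big_split; apply: eq_bigr => T _; rewrite mulrDr. Qed.

Lemma coverageZ a y v : coverage (fun T => a * y T) v = a * coverage y v.
Proof. by rewrite big_distrr; apply: eq_bigr => T _ /=; rewrite mulrCA. Qed.

Lemma coverageN y v : coverage (fun T => - y T) v = - coverage y v.
Proof. by rewrite -sumrN; apply: eq_bigr => T _ /=; rewrite mulrN. Qed.

Lemma coverage_sum (I : finType) (P : pred I) (y : I -> V * {set V} -> R) v :
  coverage (fun T => \sum_(i | P i) y i T) v = \sum_(i | P i) coverage (y i) v.
Proof.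
rewrite exchange_big; apply: eq_bigr => T _ /=.
by rewrite mulr_sumr.
Qed.

Lemma sum_bottle_weight A k T : bottle A k T ->
  \sum_v bottle_weight T v = k%:R * om + sg.
Proof.
case/bottleP => _ _ _ _ <-; rewrite big_split /= -!big_distrr /= addrC.
have -> : \sum_v (v \in T.2)%:R = #|T.2|%:R :> R.
  rewrite -sum1_card natr_sum [RHS]big_mkcond; apply: eq_bigr => v _.
  by case: (v \in _).
rewrite (bigD1 T.1) //= eqxx big1; first by rewrite addr0 mulr1 mulrC.
by move=> v /negbTE ->.
Qed.

Lemma bottle_weight_ge0 T v : 0 <= bottle_weight T v.
Proof. by rewrite addr_ge0 // mulr_ge0 ?ler0n // ltW. Qed.

Lemma coverage_ge0 y v : (forall T, 0 <= y T) -> 0 <= coverage y v.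
Proof. by move=> y0; apply: sumr_ge0 => T _; rewrite mulr_ge0 ?bottle_weight_ge0. Qed.

(** The neck of a bottle [T] receives at least [sg * y T], so every feasible weight is at most
    [sg^-1]. The tilings therefore form a bounded polytope, on which a linear objective attains its
    maximum. *)
Lemma optimal_tiling A k (c : V -> R) :
  exists2 y, fractional_tiling A k y & forall y', fractional_tiling A k y' ->
    \sum_v c v * coverage y' v <= \sum_v c v * coverage y v.
Proof.
pose M T : R := if bottle A k T then sg^-1 else 0.
have M0 T : 0 <= M T by rewrite /M; case: ifP => // _; rewrite invr_ge0 ltW.
have feas (y : V * {set V} -> R) : (forall T, 0 <= y T <= M T) /\
      (forall v, \sum_T bottle_weight T v * y T <= 1) <->
    fractional_tiling A k y.
  split=> [[yM y1]|[y0 yA y1]]; split=> //.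
  - by move=> T; case/andP: (yM T).
  - move=> T /negbTE AT; apply/eqP; rewrite eq_le.
    by have := yM T; rewrite /M AT andbC.
  - move=> T; rewrite y0 /M /=; case: ifPn => [AT|/yA -> //].
    rewrite -div1r ler_pdivlMr //; apply: le_trans (y1 T.1).
    rewrite /coverage (bigD1 T) //= mulrC; apply: ler_wpDr.
      by apply: sumr_ge0 => S _; rewrite mulr_ge0 ?bottle_weight_ge0.
    rewrite ler_wpM2r // /bottle_weight eqxx mulr1.
    by rewrite lerDl mulr_ge0 ?ler0n // ltW.
have [|y /feas fy ymax] := @lp_max R _ V (fun v T => bottle_weight T v)
    (fun=> 1) M (fun T => \sum_v c v * bottle_weight T v).
  exists (fun=> 0); split=> [T|v]; first by rewrite lexx M0.
  by rewrite big1 ?ler01 // => T _; rewrite mulr0.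
exists y => // y' /feas fy'; have := ymax _ fy'.
have E z : \sum_v c v * coverage z v =
    \sum_T (\sum_v c v * bottle_weight T v) * z T.
  under [RHS]eq_bigr do rewrite big_distrl /=.
  rewrite exchange_big /=; apply: eq_bigr => v _; rewrite big_distrr /=.
  by apply: eq_bigr => T _; rewrite mulrA.
by rewrite !E.
Qed.

End FractionalBottleTiling.

(** * Local exchanges at an optimal fractional tiling *)

Section OptimalTiling.
Variables (R : realType) (V : finType) (e : rel V).
Hypotheses (e_sym : symmetric e) (e_irr : irreflexive e).
Variables (om sg : R).
Hypotheses (sg_gt0 : 0 < sg) (sg_le_om : sg <= om).
Variables (A : {set V}) (k : nat) (c : V -> R) (y : V * {set V} -> R).
Hypothesis c_gt0 : forall v, 0 < c v.

Local Notation coverage := (coverage om sg).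
Local Notation bottle_weight := (bottle_weight om sg).
Local Notation tiling k := (fractional_tiling e om sg A k).

Hypothesis y_tiling : tiling k.+1 y.
Hypothesis y_opt : forall y', tiling k.+1 y' ->
  \sum_v c v * coverage y' v <= \sum_v c v * coverage y v.

(** First-order optimality: [d] lowers only positive weights and raises coverage only at vertices
    with room left, so a small step along [d] stays feasible and cannot increase the objective. *)
Lemma optimal_direction d :
  (forall T, d T < 0 -> 0 < y T) -> (forall T, ~~ bottle e A k.+1 T -> d T = 0) ->
  (forall v, 0 < coverage d v -> coverage y v < 1) ->
  \sum_v c v * coverage d v <= 0.
Proof.
move=> d_y d0 dcov; have [y0 yA y1] := y_tiling.
have [s s0 hs] := small_step y0 d_y.
have [|v|s' s'0 hs'] := @small_step R V (fun v => 1 - coverage y v)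
    (fun v => - coverage d v).
- by move=> v; rewrite subr_ge0.
- by rewrite oppr_lt0 subr_gt0; exact: dcov.
pose m := Num.min s s'.
have m0 : 0 < m by rewrite lt_min s0 s'0.
(* A linear constraint that holds at step zero and at step [z] also holds at the smaller step [m],
   so the two step sizes can be merged. *)
have mcomb (p q z : R) : 0 <= p -> 0 <= p + z * q -> m <= z -> 0 <= p + m * q.
  move=> p0 pz mz; have [q0|q0] := leP 0 q; first by rewrite addr_ge0 // mulr_ge0 // ltW.
  by apply: le_trans pz _; rewrite lerD2l ler_wnM2r // ltW.
have fy' : tiling k.+1 (fun T => y T + m * d T).
  split=> [T|T AT|v].
  - by apply: mcomb (hs T) _ => //; rewrite ge_min lexx.
  - by rewrite yA // d0 // mulr0 addr0.
  - rewrite coverageD coverageZ -subr_ge0 opprD addrA -mulrN.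
    by apply: mcomb (hs' v) _; rewrite ?subr_ge0 // ge_min lexx orbT.
have := y_opt fy'.
under eq_bigr do rewrite coverageD coverageZ mulrDr mulrCA.
by rewrite big_split /= -mulr_sumr gerDl pmulr_rle0.
Qed.

Lemma sum_point (x : V) (b : R) : \sum_v c v * (b * (v == x)%:R) = b * c x.
Proof.
rewrite (bigD1 x) //= eqxx mulr1 mulrC big1 ?addr0 // => v /negbTE ->.
by rewrite !mulr0.
Qed.

(** A direction that changes coverage at [x] alone and increases it there would improve the
    objective, as all weights [c] are positive. *)
Lemma exchange_gain x (d : V * {set V} -> R) (b : R) : 0 < b ->
  (forall T, d T < 0 -> 0 < y T) -> (forall T, ~~ bottle e A k.+1 T -> d T = 0) ->
  (forall v, coverage d v = b * (v == x)%:R) -> ~ coverage y x < 1.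
Proof.
move=> b0 dy dA dx yx.
have dcov v : 0 < coverage d v -> coverage y v < 1.
  by rewrite dx; case: eqP => [-> //|_]; rewrite mulr0 ltxx.
have := optimal_direction dy dA dcov; under eq_bigr do rewrite dx.
by rewrite sum_point leNgt mulr_gt0.
Qed.

Section Exchanges.
Variables (x : V) (T : V * {set V}).
Hypotheses (xA : x \in A) (x_unc : coverage y x < 1) (yT : 0 < y T).

Let T_bottle : bottle e A k.+1 T.
Proof.
by apply: contraTT yT => /(let: And3 _ yA _ := y_tiling in yA) ->; rewrite ltxx.
Qed.

Lemma delta_neg S (d0 d1 : R) : 0 <= d0 -> d0 - d1 * (S == T)%:R < 0 -> 0 < y S.
Proof.
by move=> d00; case: eqP => [-> //|_]; rewrite mulr0 subr0 ltNge d00.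
Qed.

Lemma bottle_neq0 (S S' : V * {set V}) : bottle e A k.+1 S' ->
  ~~ bottle e A k.+1 S -> (S == S')%:R = 0 :> R.
Proof. by move=> bS'; case: eqP => // ->; rewrite bS'. Qed.

(** Shifting weight from [T] to [S] moves coverage from [w] to [x]. Optimality rules out a strict
    gain, so the uncovered vertex is not worth more than the one it replaces. *)
Lemma swap_gain S a w : bottle e A k.+1 S -> 0 < a ->
  (forall v, bottle_weight S v - bottle_weight T v =
     a * (v == x)%:R - a * (v == w)%:R) -> c x <= c w.
Proof.
move=> bS a0 hS.
have := @optimal_direction (fun U => (U == S)%:R - 1 * (U == T)%:R).
have E v : coverage (fun U => (U == S)%:R - 1 * (U == T)%:R) v =
    a * (v == x)%:R - a * (v == w)%:R.
  by rewrite (coverageD _ _ (fun U => (U == S)%:R)) coverageN coverageZ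
    !coverage_delta mul1r hS.
under eq_bigr do rewrite E mulrBr.
rewrite sumrB !sum_point -mulrBr pmulr_rle0 // subr_le0; apply.
- by move=> U; apply: delta_neg; rewrite ler0n.
- by move=> U bU; rewrite !bottle_neq0 // mulr0 subr0.
- move=> v; rewrite E; have [->//|vx] := eqVneq v x.
  by rewrite mulr0 sub0r oppr_gt0 ltNge mulr_ge0 // ltW.
Qed.

Lemma swap_wide w : w \in T.2 -> e x T.1 -> {in T.2 :\ w, forall v, e x v} ->
  c x <= c w.
Proof.
move=> wT xt xW; have [tA WA tW WW cW] := bottleP _ _ _ _ T_bottle.
have xTw : x \notin T.2 :\ w by apply/negP => /xW; rewrite e_irr.
apply: (@swap_gain (T.1, x |: T.2 :\ w) om).
- apply: bottle_exchange => //; last by rewrite e_sym.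
    by move=> v /setD1P[_ /WA].
  by move=> v /setD1P[_ /tW].
- exact: lt_le_trans sg_le_om.
- by move=> v; rewrite /bottle_weight /= (@indicator_exchange R) //; ring.
Qed.

Lemma swap_neck : {in T.2, forall v, e x v} -> c x <= c T.1.
Proof.
move=> xW; have [tA WA tW WW cW] := bottleP _ _ _ _ T_bottle.
apply: (@swap_gain (x, T.2) sg) => // [|v]; first exact/bottleP.
by rewrite /bottle_weight /=; ring.
Qed.

(* The blow-up of the (k+3)-clique T + x has a tiling covering the vertices of T
   to the same extent as T does, and moreover covering x. *)
Lemma not_complete : ~ (e x T.1 /\ {in T.2, forall v, e x v}).
Proof.
case=> xt xW; have [tA WA tW WW cW] := bottleP _ _ _ _ T_bottle.
have tT := bottle_neck_notin e_irr T_bottle.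
have om0 : 0 < om by exact: lt_le_trans sg_le_om.
have xT w : x \notin T.2 :\ w by apply/negP => /setD1P[_ /xW]; rewrite e_irr.
pose S w := (T.1, x |: T.2 :\ w).
have bS w : w \in T.2 -> bottle e A k.+1 (S w).
  move=> wT; apply: bottle_exchange => //; last by move=> v /setD1P[_ /xW].
  + by move=> v /setD1P[_ /WA].
  + by move=> v /setD1P[_ /tW].
  + by rewrite e_sym.
have bX : bottle e A k.+1 (x, T.2) by exact/bottleP.
apply: (@exchange_gain x (fun U => (\sum_(w in T.2) (U == S w)%:R +
    (U == (x, T.2))%:R) - k.+1%:R * (U == T)%:R) (om *+ k.+1 + sg)) => //.
- by rewrite addr_gt0 // pmulrn_lgt0.
- by move=> U; apply: delta_neg; rewrite addr_ge0 ?ler0n // sumr_ge0.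
- move=> U bU; rewrite big1 => [|w wT]; last by rewrite bottle_neq0 ?bS.
  by rewrite !bottle_neq0 // mulr0 !addr0 subr0.
- move=> v; rewrite !coverageD coverageN coverageZ coverage_sum !coverage_delta.
  under eq_bigr do rewrite coverage_delta.
  have -> : \sum_(w in T.2) bottle_weight (S w) v =
      sg *+ k.+1 * (v == T.1)%:R +
      om * (((v == x)%:R + (v \in T.2)%:R) *+ k.+1 - (v \in T.2)%:R).
    rewrite big_split /= sumr_const cW -mulr_sumr mulrnAl; congr (_ + om * _).
    rewrite (eq_bigr (fun w => ((v == x)%:R + (v \in T.2)%:R) - (v == w)%:R)).
      by rewrite sumrB sumr_const cW sum_indicator_eq.
    by move=> w wT; rewrite (@indicator_exchange R).
  rewrite /bottle_weight /= -[om *+ _]mulr_natl -[sg *+ _]mulr_natl.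
  rewrite -[_ *+ k.+1]mulr_natl; ring.
Qed.

(* If x misses only the neck t, bottles with neck in W and one wide part on t or
   on x use the blow-up of T + x more efficiently than T, when sg < om. *)
Lemma neck_balanced : {in T.2, forall v, e x v} -> om <= sg.
Proof.
move=> xW; rewrite leNgt; apply/negP => sgom.
have [tA WA tW WW cW] := bottleP _ _ _ _ T_bottle.
have tT := bottle_neck_notin e_irr T_bottle.
have om0 : 0 < om by exact: lt_le_trans sg_le_om.
have xT w : x \notin T.2 :\ w by apply/negP => /setD1P[_ /xW]; rewrite e_irr.
have tTw w : T.1 \notin T.2 :\ w by apply: contra tT => /setD1P[].
pose S z w := (w, z |: T.2 :\ w).
have bS z w : z \in A -> {in T.2, forall v, e z v} -> w \in T.2 ->
    bottle e A k.+1 (S z w).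
  move=> zA zW wT; apply: bottle_exchange => //; first exact: WA.
  + by move=> v /setD1P[_ /WA].
  + by move=> v /setD1P[vw vT]; apply: WW => //; rewrite eq_sym.
  + by rewrite e_sym zW.
  + by move=> v /setD1P[_ /zW].
(* [b1] and [b2] solve two balance equations: [(b1 + b2) * D = om] preserves the coverage on [T.2],
   and [b2 * (k.+1%:R * om) = sg] preserves it at the neck. What remains is a surplus at [x],
   positive because [sg < om] gives [0 < b1]. *)
pose D := sg + k%:R * om.
have D0 : 0 < D by rewrite ltr_pwDl // mulr_ge0 // ltW.
pose b2 := sg / (k.+1%:R * om); pose b1 := om / D - b2.
have k0 : 0 < k.+1%:R * om by rewrite mulr_gt0.
have b20 : 0 <= b2 by rewrite divr_ge0 // ltW.
have b10 : 0 < b1.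
  rewrite subr_gt0 ltr_pdivrMr // mulrAC ltr_pdivlMr // /D -natr1.
  have h1 : 0 <= k%:R * om * (om - sg) by rewrite !mulr_ge0 ?subr_ge0 // ltW.
  have h2 : 0 < (om - sg) * (om + sg) by rewrite mulr_gt0 ?subr_gt0 ?addr_gt0.
  by lra.
apply: (@exchange_gain x (fun U => (b1 * \sum_(w in T.2) (U == S x w)%:R +
    b2 * \sum_(w in T.2) (U == S T.1 w)%:R) - 1 * (U == T)%:R)
    (k.+1%:R * (b1 * om))) => //.
- by rewrite !mulr_gt0.
- move=> U; apply: delta_neg.
  by rewrite addr_ge0 // mulr_ge0 ?sumr_ge0 // ltW.
- move=> U bU; rewrite !big1 => [|w wT|w wT]; try by rewrite bottle_neq0 ?bS.
  by rewrite bottle_neq0 // !mulr0 !addr0 subr0.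
- move=> v; rewrite !coverageD coverageN !coverageZ !coverage_sum !coverage_delta.
  have SE z : z \notin T.2 -> \sum_(w in T.2) coverage (fun U => (U == S z w)%:R) v =
      sg * (v \in T.2)%:R +
      om * (k.+1%:R * ((v == z)%:R + (v \in T.2)%:R) - (v \in T.2)%:R).
    move=> zT; under eq_bigr do rewrite coverage_delta.
    rewrite big_split /= -!mulr_sumr sum_indicator_eq; congr (_ + om * _).
    rewrite (eq_bigr (fun w => ((v == z)%:R + (v \in T.2)%:R) - (v == w)%:R)).
      by rewrite sumrB sumr_const cW sum_indicator_eq mulr_natl.
    move=> w wT; rewrite (@indicator_exchange R) //.
    by apply: contra zT => /setD1P[].
  rewrite !SE //; last by apply/negP => /xW; rewrite e_irr.
  rewrite /bottle_weight.
  have h1 : (b1 + b2) * D = om by rewrite /b1 subrK divfK // gt_eqF.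
  have h2 : b2 * (k.+1%:R * om) = sg by rewrite /b2 divfK // gt_eqF.
  clearbody b1 b2; move: h1 h2; rewrite /D -natr1 => h1 h2.
  transitivity ((v \in T.2)%:R * ((b1 + b2) * (sg + k%:R * om)) +
     (v == x)%:R * (b1 * om * (k%:R + 1)) +
     (v == T.1)%:R * (b2 * ((k%:R + 1) * om)) -
     (sg * (v == T.1)%:R + om * (v \in T.2)%:R)); first ring.
  rewrite h1 h2; ring.
Qed.

End Exchanges.

(** A clique of [k.+2] vertices with room left would carry a bottle whose weight can be raised,
    which improves the objective. *)
Lemma uncovered_clique_small (Q : {set V}) : Q \subset A ->
  {in Q, forall v, coverage y v < 1} -> {in Q &, forall v w, v != w -> e v w} ->
  (#|Q| <= k.+1)%N.
Proof.
move=> QA Qu Qe; rewrite leqNgt; apply/negP => kQ.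
have [[[] //|t s] [/= /andP[ts us] [ss] sQ]] := card_geqP kQ.
have tQ : t \in Q by apply: sQ; rewrite inE eqxx.
have {}sQ : {subset s <= Q} by move=> v vs; apply: sQ; rewrite inE vs orbT.
pose T := (t, [set v in s]).
have bT : bottle e A k.+1 T.
  apply/bottleP; split=> /=; first exact: (subsetP QA).
  - by move=> v; rewrite inE => /sQ/(subsetP QA).
  - move=> v; rewrite inE => vs; apply: Qe => //; first exact: sQ.
    by apply: contraNneq ts => ->.
  - by move=> v w; rewrite !inE => /sQ vQ /sQ wQ; apply: Qe.
  - by rewrite cardsE (card_uniqP us).
have := @optimal_direction (fun U => (U == T)%:R).
have -> : \sum_v c v * coverage (fun U => (U == T)%:R) v =
    \sum_v c v * bottle_weight T v.
  by apply: eq_bigr => v _; rewrite coverage_delta.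
rewrite leNgt (bigD1 t) //= ltr_wpDr ?mulr_gt0 //; last first.
- by rewrite /bottle_weight eqxx mulr1 ltr_wpDr // mulr_ge0 // ltW //
    (lt_le_trans sg_gt0).
- by apply: sumr_ge0 => v _; rewrite mulr_ge0 ?bottle_weight_ge0 // ltW.
move=> H; suff : ~~ true by []; apply: H => [U|U|v].
- by rewrite ltNge ler0n.
- by case: eqP => [->|//]; rewrite bT.
rewrite coverage_delta /bottle_weight inE /= => h; apply: Qu; move: h.
case: eqP => [->//|_]; rewrite mulr0 add0r; case: (boolP (v \in s)) => [/sQ//|_].
by rewrite mulr0 ltxx.
Qed.

End OptimalTiling.

(** * Bounding the uncovered part, and induction on the size of the bottles *)

Section AlmostPerfectFractionalTiling.
Variables (R : realType) (V : finType) (e : rel V).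
Hypotheses (e_sym : symmetric e) (e_irr : irreflexive e).
Variables (om sg : R).
Hypotheses (sg_gt0 : 0 < sg) (sg_le_om : sg <= om).

Local Notation coverage := (coverage om sg).
Local Notation bottle_weight := (bottle_weight om sg).
Local Notation tiling := (fractional_tiling e om sg).

Let om_gt0 : 0 < om. Proof. exact: lt_le_trans sg_le_om. Qed.

Lemma sum_bottle_weight_cond (A : {set V}) k T (P : pred V) : bottle e A k T ->
  \sum_(v in A | P v) bottle_weight T v =
    sg * (P T.1)%:R + om * #|[set w in T.2 | P w]|%:R.
Proof.
case/bottleP => tA WA _ _ _; rewrite big_split /= -!mulr_sumr; congr (_ * _ + _ * _).
  have [Pt|Pt] := boolP (P T.1).
    rewrite (bigD1 T.1) /= ?tA // eqxx big1 ?addr0 // => v /andP[_ /negbTE ->] //.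
  by rewrite big1 // => v /andP[_ Pv]; case: eqP => // vt; rewrite -vt Pv in Pt.
rewrite -sum1_card natr_sum big_mkcond [RHS]big_mkcond /=.
apply: eq_bigr => v _; rewrite inE; case: (boolP (v \in T.2)) => [/WA ->|_] /=.
  by case: (P v).
by case: ifP.
Qed.

Lemma sum_coverage_cond (A : {set V}) y (P : pred V) :
  \sum_(v in A | P v) coverage y v =
    \sum_T (\sum_(v in A | P v) bottle_weight T v) * y T.
Proof. by rewrite exchange_big; apply: eq_bigr => T _; rewrite mulr_suml. Qed.

Lemma sum_coverage (A : {set V}) k y : tiling A k y ->
  \sum_v coverage y v = (k%:R * om + sg) * \sum_T y T.
Proof.
case=> _ yA _; rewrite exchange_big mulr_sumr; apply: eq_bigr => T _ /=.
rewrite -mulr_suml; have [bT|bT] := boolP (bottle e A k T).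
  by rewrite (sum_bottle_weight _ _ bT).
by rewrite yA // !mulr0.
Qed.

Lemma coverage_out (A : {set V}) k y v : tiling A k y -> v \notin A ->
  coverage y v = 0.
Proof.
case=> _ yA _ vA; apply: big1 => T _.
have [/bottleP[tA WA _ _ _]|bT] := boolP (bottle e A k T); last by rewrite yA ?mulr0.
rewrite /bottle_weight; case: eqP => [vt|_]; first by rewrite vt tA in vA.
by case: (boolP (v \in T.2)) => [/WA|_]; rewrite ?(negbTE vA) // !mulr0 addr0 mul0r.
Qed.

Section Optimum.
Variables (A : {set V}) (k : nat) (c kap : V -> R) (y : V * {set V} -> R).
Hypothesis c_gt0 : forall v, 0 < c v.
Hypothesis c_kap : forall v w, c v <= c w -> kap v <= kap w.
Hypothesis y_tiling : tiling A k.+1 y.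
Hypothesis y_opt : forall y', tiling A k.+1 y' ->
  \sum_v c v * coverage y' v <= \sum_v c v * coverage y v.

(** The cases are what [x] misses of [T]. The exchanges exclude missing nothing. Two wide vertices,
    or the neck and a wide vertex, already weigh at least [om + sg]. A single missed wide vertex [w]
    weighs [om] and has [kap x <= kap w], so the second sum adds [sg]. If only the neck is missed,
    then [sg = om] and the neck counts in both sums. *)
Lemma missed_weight x T : x \in A -> coverage y x < 1 -> 0 < y T ->
  om + sg <= \sum_(v in A | ~~ e x v) bottle_weight T v +
    sg / om * \sum_(v in A | kap x <= kap v) bottle_weight T v.
Proof.
move=> xA ux yT; have bT : bottle e A k.+1 T.
  apply: contraTT yT; case: y_tiling => _ yA _ /yA ->; by rewrite ltxx.
rewrite !(sum_bottle_weight_cond _ bT).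
set N := [set w in T.2 | ~~ e x w]; set K := [set w in T.2 | kap x <= kap w].
have K0 : 0 <= sg / om * (sg * (kap x <= kap T.1)%R%:R + om * #|K|%:R).
  by rewrite mulr_ge0 ?divr_ge0 ?addr_ge0 ?mulr_ge0 ?ler0n // ltW.
have xN w : w \in T.2 -> w \notin N -> e x w by move=> wT; rewrite inE wT negbK.
have [xt|xt] /= := boolP (e x T.1); rewrite ?mulr0 ?mulr1 ?add0r.
  have [N0|N0] := posnP #|N|.
    case: (not_complete e_sym e_irr sg_gt0 sg_le_om c_gt0 y_tiling y_opt xA ux yT).
    by split=> // w wT; apply: xN => //; rewrite (cards0_eq N0) inE.
  have [N1|N2] := leqP #|N| 1; last first.
    have : 2%:R <= #|N|%:R :> R by rewrite ler_nat.
    have := sg_le_om; have := om_gt0; nra.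
  have {N0 N1}/eqP/cards1P[w Nw] : #|N| = 1%N by apply/eqP; rewrite eqn_leq N1.
  have /setIdP[wT _] : w \in N by rewrite Nw set11.
  have /c_kap kw : c x <= c w.
    apply: (swap_wide e_sym e_irr sg_gt0 sg_le_om y_tiling y_opt xA ux yT) => //.
    move=> v /setD1P[vw vT]; apply: xN => //.
    by rewrite Nw inE.
  have : 1 <= #|K|%:R :> R.
    by rewrite ler1n card_gt0; apply/set0Pn; exists w; rewrite inE wT kw.
  rewrite Nw cards1 mulr1 lerD2l => K1.
  rewrite -{1}[sg](divfK (_ : om != 0)) ?gt_eqF // ler_pM2l ?divr_gt0 //.
  by rewrite ler_wpDl ?ler_peMr ?mulr_ge0 ?ler0n // ltW.
have [N0|N0] := posnP #|N|; last first.
  apply: (@le_trans _ _ (sg + om * #|N|%:R)); last by rewrite lerDl.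
  by rewrite addrC lerD2l ler_peMr ?ler1n // ltW.
have xW : {in T.2, forall v, e x v}.
  by move=> w wT; apply: xN => //; rewrite (cards0_eq N0) inE.
have som := neck_balanced e_sym e_irr sg_gt0 sg_le_om c_gt0 y_tiling y_opt xA ux yT xW.
have /c_kap -> := swap_neck sg_gt0 y_tiling y_opt xA ux yT xW.
have <- : sg = om by apply/eqP; rewrite eq_le sg_le_om.
rewrite N0 mulr0 addr0 mulr1 lerD2l divff ?gt_eqF // mul1r.
by rewrite lerDl mulr_ge0 // ltW.
Qed.

(** Multiply the bound of [missed_weight] by [y T] and sum over all bottles: the coverage of the two
    vertex sets, the second one scaled by [sg / om], is at least [(om + sg) * \sum_T y T], while
    their sizes, scaled alike, add up to at most [(om + sg) * u]. *)
Lemma uncovered_bound u x : x \in A -> coverage y x < 1 ->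
  #|[set v in A | ~~ e x v]|%:R <= kap x ->
  kap x + sg / om * #|[set v in A | (kap x <= kap v)%R]|%:R <= (om + sg) * u ->
  \sum_(v in A | ~~ e x v) (1 - coverage y v) +
    sg / om * \sum_(v in A | kap x <= kap v) (1 - coverage y v) <=
  (om + sg) * (u - \sum_T y T).
Proof.
move=> xA ux xk; have cardE (P : pred V) :
    #|[set v in A | P v]|%:R = \sum_(v in A | P v) (1 : R).
  by rewrite -sum1_card natr_sum; apply: eq_bigl => v; rewrite inE.
move: xk; rewrite !sumrB !cardE.
set n1 := \sum_(v in A | ~~ e x v) 1; set n2 := \sum_(v in A | kap x <= kap v) 1.
rewrite !sum_coverage_cond => n1k lowx.
have : (om + sg) * \sum_T y T <=
    \sum_T (\sum_(v in A | ~~ e x v) bottle_weight T v) * y T +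
    sg / om * \sum_T (\sum_(v in A | kap x <= kap v) bottle_weight T v) * y T.
  rewrite [X in _ <= _ + X]mulr_sumr -big_split mulr_sumr; apply: ler_sum => T _ /=.
  rewrite mulrA -mulrDl; case: y_tiling => y0 _ _.
  have := y0 T; rewrite le_eqVlt => /orP[/eqP <-|yT]; first by rewrite !mulr0.
  by rewrite ler_pM2r //; apply: missed_weight.
move: lowx n1k; move: n1 n2; set s1 := \sum_T _; set s2 := \sum_T _ * _.
set s3 := \sum_T _; move: s1 s2 s3 (sg / om) => s1 s2 s3 q n1 n2; lra.
Qed.

(** Take [x] of least [kap] among the uncovered vertices and a largest clique [Q] of uncovered
    vertices through [x]. Every uncovered vertex is missed by some member of [Q], so the
    non-neighbour sums over [Q] count the whole deficit, and the second sum for [x] counts it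
    [sg / om] times more. With [#|Q| <= k.+1] this gives the bound. *)
Lemma total_uncovered_bound u : \sum_T y T <= u ->
  (forall x, x \in A -> #|[set v in A | ~~ e x v]|%:R <= kap x) ->
  (forall x, x \in A -> coverage y x < 1 ->
     kap x + sg / om * #|[set v in A | (kap x <= kap v)%R]|%:R <= (om + sg) * u) ->
  \sum_(v in A) (1 - coverage y v) <= k.+1%:R * om * (u - \sum_T y T).
Proof.
move=> Yu hk low; have [y0 yA y1] := y_tiling.
have un0 v : 0 <= 1 - coverage y v by rewrite subr_ge0.
pose U := [set v in A | coverage y v < 1].
have un_eq0 v : v \in A -> v \notin U -> 1 - coverage y v = 0.
  move=> vA; rewrite inE vA -leNgt => v1.
  by apply/eqP; rewrite subr_eq0 eq_le v1 y1.
have [U0|[x0 x0U]] := set_0Vmem U.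
  rewrite big1 => [|v vA]; last by rewrite un_eq0 // U0 inE.
  by rewrite !mulr_ge0 ?subr_ge0 // ltW.
case: (@arg_minP _ _ _ x0 (mem U) kap x0U) => x xU' xmin; have {xU'} xU : x \in U := xU'.
pose clq (Q : {set V}) := [&& x \in Q, Q \subset U &
  [forall v in Q, forall w in Q, (v != w) ==> e v w]].
have clqx : clq [set x].
  rewrite /clq set11 sub1set xU; apply/forall_inP => v /set1P ->.
  by apply/forall_inP => w /set1P ->; rewrite eqxx.
case: (@arg_maxnP _ [set x] clq (fun Q => #|Q|) clqx) => Q /and3P[xQ QU Qe] Qmax.
have {}Qe : {in Q &, forall v w, v != w -> e v w}.
  by move=> v w vQ wQ; apply/implyP; exact: (forall_inP (forall_inP Qe v vQ)).
have QA q : q \in Q -> (q \in A) * (coverage y q < 1).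
  by move=> /(subsetP QU); rewrite inE => /andP[].
have cQ : (#|Q| <= k.+1)%N.
  apply: (uncovered_clique_small sg_gt0 sg_le_om c_gt0 y_tiling y_opt) => //.
    by apply/subsetP => q /QA[].
  by move=> q /QA[].
(* A vertex of [U] adjacent to all of [Q] would extend the clique; members of [Q] miss themselves by
   irreflexivity. *)
have Qdom v : v \in U -> exists2 q, q \in Q & ~~ e q v.
  move=> vU; apply/exists_inP; apply: contraT => /exists_inPn Qv.
  have {}Qv q : q \in Q -> e q v by move=> /Qv; rewrite negbK.
  have vQ : v \notin Q by apply/negP => /Qv; rewrite e_irr.
  have /Qmax h : clq (v |: Q).
    rewrite /clq !inE xQ orbT subUset sub1set vU QU /=.
    apply/forall_inP => a /setU1P aQ; apply/forall_inP => b /setU1P bQ.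
    apply/implyP; case: aQ bQ => [->|aQ] [->|bQ]; rewrite ?eqxx // => ab.
    - by rewrite e_sym Qv.
    - exact: Qv.
    - exact: Qe.
  by have := leq_trans h (leqnn _); rewrite cardsU1 vQ ltnn.
set S := \sum_(v in A) _.
have S1 : S <= \sum_(q in Q) \sum_(v in A | ~~ e q v) (1 - coverage y v).
  rewrite (exchange_big_dep (mem A)) /=; last by move=> q v _ /andP[].
  apply: ler_sum => v vA; have [vU|vU] := boolP (v \in U); last first.
    by rewrite un_eq0 // big1.
  have [q qQ qv] := Qdom _ vU.
  by rewrite (bigD1 q) /= ?qQ ?vA // lerDl sumr_ge0.
(* By the choice of [x], every vertex with a positive deficit satisfies [kap x <= kap v]. *)
have S2 : S = \sum_(v in A | kap x <= kap v) (1 - coverage y v).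
  rewrite /S (bigID (fun v => kap x <= kap v)) /= [X in _ + X]big1 ?addr0 // => v.
  case/andP => vA xv; apply: un_eq0 => //; apply: contra xv => vU.
  exact: xmin.
have S0 : 0 <= S by apply: sumr_ge0.
have bound q : q \in Q -> \sum_(v in A | ~~ e q v) (1 - coverage y v) +
    sg / om * S * (q == x)%:R <= (om + sg) * (u - \sum_T y T).
  move=> qQ; have [qA qu] := QA q qQ.
  apply: le_trans (uncovered_bound qA qu (hk q qA) (low q qA qu)).
  rewrite lerD2l -mulrA ler_pM2l ?divr_gt0 //.
  have [->|_] := eqVneq q x; first by rewrite mulr1 S2.
  by rewrite mulr0 sumr_ge0.
have : \sum_(q in Q) (\sum_(v in A | ~~ e q v) (1 - coverage y v) +
    sg / om * S * (q == x)%:R) <= \sum_(q in Q) (om + sg) * (u - \sum_T y T).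
  exact: ler_sum.
rewrite big_split /= -mulr_sumr sumr_const.
have -> : \sum_(q in Q) (q == x)%:R = 1 :> R.
  by rewrite (bigD1 x) //= eqxx big1 ?addr0 // => q /andP[_ /negbTE ->].
rewrite mulr1 -[_ *+ #|Q|]mulr_natl => h.
have {}h : S + sg / om * S <= k.+1%:R * ((om + sg) * (u - \sum_T y T)).
  apply: le_trans (lerD S1 (lexx _)) (le_trans h _).
  by rewrite ler_wpM2r ?ler_nat // mulr_ge0 ?subr_ge0 // addr_ge0 // ltW.
have os : 0 < (om + sg) / om by rewrite divr_gt0 // addr_gt0.
rewrite -(ler_pM2l os); apply: le_trans (le_trans h _).
  by rewrite mulrDl divff ?gt_eqF // mulrDl mul1r.
by rewrite le_eqVlt; apply/orP; left; apply/eqP; field; rewrite gt_eqF.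
Qed.

End Optimum.

(** Induction on [k]. Since [kap] is fixed while [A] shrinks, the degree hypotheses pass to subsets.
    Passing to the neighbourhood of a vertex with [kap x <= om * u] costs one term [om * u] of the
    size condition, which matches one wide vertex less. The gap between [m'] and [m] leaves room for
    a perturbed objective. *)
Lemma almost_perfect_fractional_tiling (kap : V -> R) (u m m' : R) :
  (forall v, 0 <= kap v) -> m' < m -> m <= u ->
  forall k (A : {set V}),
  (forall x, x \in A -> #|[set v in A | ~~ e x v]|%:R <= kap x) ->
  (forall x, x \in A -> kap x <= om * u \/
     kap x + sg / om * #|[set v in A | (kap x <= kap v)%R]|%:R <= (om + sg) * u) ->
  k%:R * om * u + sg * m <= #|A|%:R ->
  exists2 y, tiling A k y & m' <= \sum_T y T.
Proof.
move=> kap0 m'm mu k; elim: k m m' m'm mu => [|k IHk] m m' m'm mu A hk hA cA.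
  (* Without wide vertices a bottle is a single vertex, and weight [sg^-1] on each covers [A]
     exactly. *)
  exists (fun T => \sum_(v in A) sg^-1 * (T == (v, set0))%:R); last first.
    rewrite exchange_big /= (eq_bigr (fun=> sg^-1)) => [|v vA]; last first.
      rewrite -mulr_sumr (bigD1 (v, set0)) //= eqxx big1 ?addr0 ?mulr1 //.
      by move=> T /negbTE ->.
    rewrite sumr_const -mulr_natl ler_pdivlMr //; apply: le_trans cA.
    by rewrite !mul0r add0r mulrC ler_pM2l // ltW.
  split=> [T|T bT|v].
  - by apply: sumr_ge0 => v _; rewrite mulr_ge0 // invr_ge0 ltW.
  - apply: big1 => v vA; case: eqP => [TE|_]; last by rewrite mulr0.
    case/negP: bT; rewrite TE; apply/bottleP.
    by split=> //= [w|w|w w'|]; rewrite ?inE ?cards0.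
  - rewrite coverage_sum; under eq_bigr do rewrite coverageZ coverage_delta.
    rewrite (eq_bigr (fun w => (v == w)%:R)) => [|w _]; last first.
      by rewrite /bottle_weight /= inE mulr0 addr0 mulKf // gt_eqF.
    by rewrite sum_indicator_eq; case: (v \in A).
have [m'0|m'0] := leP m' 0.
  exists (fun=> 0); last by rewrite big1.
  by split=> // v; rewrite /coverage big1 ?ler01 // => T _; rewrite mulr0.
have u0 : 0 < u by apply: lt_le_trans mu; apply: lt_trans m'm.
(* [ep] satisfies [(1 + ep) * m' = m'']. As [1 <= c v <= 1 + ep] on [A], the perturbation of the
   objective cannot outweigh the gap between totals below [m'] and totals of at least [m'']. *)
pose m'' := (m + m') / 2; pose ep := (m'' - m') / m'.
have ep0 : 0 < ep by rewrite divr_gt0 // /m''; lra.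
have m''m : m'' < m by rewrite /m''; lra.
have epE : (1 + ep) * m' = m'' by rewrite /ep; field; rewrite gt_eqF.
pose K := (om + sg) * u; have K0 : 0 < K by rewrite mulr_gt0 // addr_gt0.
pose c v := 1 + ep * (kap v / K).
have c1 v : 1 <= c v.
  rewrite /c lerDl; apply: mulr_ge0; first exact: ltW.
  by apply: divr_ge0; [exact: kap0|exact: ltW].
have c0 v : 0 < c v by apply: lt_le_trans (c1 v).
have cA1 v : v \in A -> c v <= 1 + ep.
  move=> vA; rewrite /c lerD2l ler_piMr ?(ltW ep0) // ler_pdivrMr // mul1r.
  case: (hA v vA) => [h|]; last by apply: le_trans; rewrite lerDl mulr_ge0 ?divr_ge0 // ltW.
  by apply: le_trans h _; rewrite /K ler_pM2r // lerDl ltW.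
have c_kap v w : c v <= c w -> kap v <= kap w.
  by rewrite /c lerD2l ler_pM2l // ler_pM2r // invr_gt0.
have [y fy ymax] := optimal_tiling e sg_gt0 sg_le_om A k.+1 c.
have [?|Ym'] := leP m' (\sum_T y T); first by exists y.
have [y0 yA y1] := fy.
(* Such an [x] is an uncovered vertex of high degree. Without one, [total_uncovered_bound]
   contradicts the size of [A], because the total of [y] is below [m]. *)
pose high := [exists x in A, (coverage y x < 1) && (kap x <= om * u)].
have [/exists_inP[x xA /andP[ux hx]]|nohigh] := boolP high; last first.
  have Yu : \sum_T y T <= u by apply: ltW; apply: lt_le_trans mu; apply: lt_trans m'm.
  have low x : x \in A -> coverage y x < 1 ->
      kap x + sg / om * #|[set v in A | (kap x <= kap v)%R]|%:R <= (om + sg) * u.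
    move=> xA ux; case: (hA x xA) => // hx; case/negP: nohigh.
    by apply/exists_inP; exists x => //; rewrite ux.
  have := total_uncovered_bound c0 c_kap fy ymax Yu hk low.
  rewrite sumrB sumr_const.
  have -> : \sum_(v in A) coverage y v = \sum_v coverage y v.
    rewrite [RHS](bigID (mem A)) /= [X in _ + X]big1 ?addr0 // => v.
    exact: coverage_out fy.
  rewrite (sum_coverage fy) => h.
  have : 0 < sg * (m - \sum_T y T).
    by rewrite mulr_gt0 // subr_gt0; apply: lt_trans m'm.
  move: h cA; set q := k.+1%:R; set Y := \sum_T y T; lra.
pose B := [set v in A | e x v].
have BA : B \subset A by apply/subsetP => v /setIdP[].
have cBA (P : pred V) : (#|[set v in B | P v]| <= #|[set v in A | P v]|)%N.
  by apply: subset_leq_card; apply/subsetP => v /setIdP[/(subsetP BA)]; rewrite inE => -> ->.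
have [z [z0 zB z1] zm] : exists2 z, tiling B k z & m'' <= \sum_T z T.
  apply: (IHk m) => // [v /(subsetP BA) vA|v /(subsetP BA) vA|].
  - apply: le_trans (hk v vA); rewrite ler_nat; exact: cBA.
  - case: (hA v vA) => h; [by left|right]; apply: le_trans h.
    by rewrite lerD2l ler_pM2l ?divr_gt0 // ler_nat; exact: cBA.
  - have : #|A|%:R = #|B|%:R + #|[set v in A | ~~ e x v]|%:R :> R.
      rewrite -natrD; congr _%:R; rewrite -(cardsID [set v | e x v] A).
      by congr (_ + _)%N; apply: eq_card => v; rewrite !inE // andbC.
    move: (hk x xA) hx cA; rewrite -natr1; set q := k%:R; lra.
pose ext (T : V * {set V}) := (T.1, x |: T.2).
(* The direction replaces all of [y] by the tiling [z] of the neighbourhood, with [x] added to each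
   bottle as a wide vertex. At the full step [x] might be covered too often, but only a small step
   is taken. *)
pose d U := \sum_T z T * (U == ext T)%:R - y U.
have bext T : bottle e B k T -> bottle e A k.+1 (ext T).
  case/bottleP => tB WB tW WW cW; apply/bottleP; split=> /=.
  - exact: (subsetP BA).
  - by move=> v /setU1P[-> //|/WB/(subsetP BA)].
  - move=> v /setU1P[->|/tW //]; rewrite e_sym.
    by move: tB; rewrite inE => /andP[].
  - move=> v w /setU1P[->|vW] /setU1P[->|wW]; rewrite ?eqxx // => vw.
    + by move: (WB _ wW); rewrite inE => /andP[].
    + by rewrite e_sym; move: (WB _ vW); rewrite inE => /andP[].
    + exact: WW.
  - rewrite cardsU1 cW (_ : x \notin T.2) //.
    by apply/negP => /WB; rewrite inE e_irr andbF.
have covd v : coverage d v =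
    coverage z v + om * (\sum_T z T) * (v == x)%:R - coverage y v.
  rewrite /d (coverageD _ _ (fun U => \sum_T z T * (U == ext T)%:R)) coverageN.
  have -> : coverage z v = \sum_T bottle_weight T v * z T by [].
  congr (_ - _); rewrite coverage_sum.
  rewrite mulrAC mulr_sumr -big_split /=; apply: eq_bigr => T _.
  rewrite coverageZ coverage_delta.
  have [bT|/zB ->] := boolP (bottle e B k T); last by rewrite !(mulr0, mul0r) addr0.
  rewrite -mulrDl mulrC; congr (_ * _); rewrite /bottle_weight /= -addrA; congr (_ + _).
  rewrite -mulrDr; congr (_ * _); rewrite !inE -natrD; congr _%:R.
  case: eqP => [->|_] /=; rewrite ?addn0 // (_ : x \in T.2 = false) //.
  apply/negbTE/negP; case/bottleP: bT => _ WB _ _ _ /WB.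
  by rewrite inE e_irr andbF.
have /negP[] : ~~ (\sum_v c v * coverage d v <= 0); last first.
  apply: (optimal_direction fy ymax) => [U|U bU|v].
  - rewrite /d subr_lt0; apply: le_lt_trans; apply: sumr_ge0 => T _.
    by rewrite mulr_ge0 ?ler0n.
  - rewrite /d yA // subr0; apply: big1 => T _.
    have [bT|/zB ->] := boolP (bottle e B k T); last by rewrite mul0r.
    case: eqP => [UE|_]; last by rewrite mulr0.
    by rewrite UE bext in bU.
  - rewrite covd; have [->//|_] := eqVneq v x.
    by rewrite mulr0 addr0 subr_gt0 => /lt_le_trans; apply.
have Bz : tiling B k z by split.
have E : \sum_v c v * coverage d v = \sum_v c v * coverage z v +
    om * (\sum_T z T) * c x - \sum_v c v * coverage y v.
  under eq_bigr do rewrite covd mulrBr mulrDr.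
  by rewrite sumrB big_split /= sum_point.
have h1 : (k%:R * om + sg) * \sum_T z T <= \sum_v c v * coverage z v.
  rewrite -(sum_coverage Bz); apply: ler_sum => v _.
  by rewrite ler_peMl ?coverage_ge0.
have z00 : 0 <= \sum_T z T by apply: sumr_ge0.
have h2 : om * \sum_T z T <= om * (\sum_T z T) * c x.
  by rewrite ler_peMr // mulr_ge0 // ltW.
have h3 : \sum_v c v * coverage y v <= (1 + ep) * ((k.+1%:R * om + sg) * \sum_T y T).
  rewrite -(sum_coverage fy) mulr_sumr; apply: ler_sum => v _.
  have [vA|vA] := boolP (v \in A); last by rewrite (coverage_out fy vA) !mulr0.
  by rewrite ler_wpM2r ?coverage_ge0 // cA1.
rewrite -ltNge E.
have h4 : 0 < (k.+1%:R * om + sg) * (\sum_T z T - (1 + ep) * \sum_T y T).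
  apply: mulr_gt0; first by rewrite addr_gt0 // mulr_gt0.
  rewrite subr_gt0; apply: lt_le_trans zm; rewrite -epE ltr_pM2l //.
  by rewrite addr_gt0.
move: h1 h2 h3 h4; rewrite -natr1; set q := k%:R; set s1 := \sum_v _; set s2 := \sum_v _.
set s3 := \sum_T _; set s4 := \sum_T _; lra.
Qed.


End AlmostPerfectFractionalTiling.

(** * Averages over sequences of vertices *)

Section Averages.
Variables (R : realFieldType) (V : finType).
Hypothesis V_gt0 : (0 < #|V|)%N.

Definition avg (f : V -> R) : R := (\sum_v f v) / #|V|%:R.

(** The expectation of [F] over [m] independent uniform vertices, repetitions allowed. The recursive
    form makes linearity and exchange of averages inductions on [m]. *)
Fixpoint seq_avg (m : nat) (F : seq V -> R) : R :=
  if m is m'.+1 then avg (fun v => seq_avg m' (fun s => F (v :: s))) else F [::].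

Lemma seq_avgS m F :
  seq_avg m.+1 F = avg (fun v => seq_avg m (fun s => F (v :: s))).
Proof. by []. Qed.

Let nV0 : #|V|%:R != 0 :> R. Proof. by rewrite pnatr_eq0 -lt0n. Qed.

Lemma eq_avg f g : f =1 g -> avg f = avg g.
Proof. by move=> fg; rewrite /avg (eq_bigr g). Qed.

Lemma ler_avg f g : (forall v, f v <= g v) -> avg f <= avg g.
Proof. by move=> fg; rewrite ler_wpM2r ?invr_ge0 // ler_sum. Qed.

Lemma avg_const a : avg (fun=> a) = a.
Proof. by rewrite /avg sumr_const -[a *+ _]mulr_natr mulfK. Qed.

Lemma avgD f g : avg (fun v => f v + g v) = avg f + avg g.
Proof. by rewrite /avg big_split mulrDl. Qed.

Lemma avgZ a f : avg (fun v => a * f v) = a * avg f.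
Proof. by rewrite /avg -mulr_sumr mulrA. Qed.

Lemma avg_ge0 f : (forall v, 0 <= f v) -> 0 <= avg f.
Proof. by move=> f0; rewrite -(avg_const 0) ler_avg. Qed.

Lemma avg_le1 f : (forall v, f v <= 1) -> avg f <= 1.
Proof. by move=> f0; rewrite -(avg_const 1) ler_avg. Qed.

Lemma avg_sum (I : finType) (P : pred I) (f : I -> V -> R) :
  avg (fun v => \sum_(i | P i) f i v) = \sum_(i | P i) avg (f i).
Proof. by rewrite /avg exchange_big mulr_suml. Qed.

Lemma avg_exists f a : a <= avg f -> exists v, a <= f v.
Proof.
move=> af; apply/existsP; apply: contraLR af; rewrite negb_exists => /forallP fa.
rewrite -ltNge /avg ltr_pdivrMr ?ltr0n // mulr_natr -sumr_const.
have [v _] := card_gt0P V_gt0.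
by apply: ltr_sum => [|i _]; [apply/hasP; exists v; rewrite ?mem_index_enum|rewrite ltNge].
Qed.

Lemma eq_seq_avg m F G : (forall s, size s = m -> F s = G s) ->
  seq_avg m F = seq_avg m G.
Proof.
elim: m F G => [|m IHm] F G FG /=; first exact: FG.
by apply: eq_avg => v; apply: IHm => s sm; rewrite FG //= sm.
Qed.

Lemma ler_seq_avg m F G : (forall s, size s = m -> F s <= G s) ->
  seq_avg m F <= seq_avg m G.
Proof.
elim: m F G => [|m IHm] F G FG /=; first exact: FG.
by apply: ler_avg => v; apply: IHm => s sm; rewrite FG //= sm.
Qed.

Lemma seq_avg_const m a : seq_avg m (fun=> a) = a.
Proof. by elim: m => //= m IHm; rewrite IHm avg_const. Qed.

Lemma seq_avgD m F G :
  seq_avg m (fun s => F s + G s) = seq_avg m F + seq_avg m G.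
Proof.
elim: m F G => [//|m IHm] F G /=; rewrite -avgD.
by apply: eq_avg => v; rewrite IHm.
Qed.

Lemma seq_avgZ m a F : seq_avg m (fun s => a * F s) = a * seq_avg m F.
Proof.
elim: m F => [//|m IHm] F /=; rewrite -avgZ.
by apply: eq_avg => v; rewrite IHm.
Qed.

Lemma seq_avg_sum (I : finType) m (P : pred I) (F : I -> seq V -> R) :
  seq_avg m (fun s => \sum_(i | P i) F i s) = \sum_(i | P i) seq_avg m (F i).
Proof.
elim: m F => [//|m IHm] F /=; rewrite -avg_sum.
by apply: eq_avg => v; rewrite IHm.
Qed.

Lemma avg_seq_avg m (F : V -> seq V -> R) :
  avg (fun v => seq_avg m (F v)) = seq_avg m (fun s => avg (fun v => F v s)).
Proof.
rewrite {1}/avg -seq_avg_sum mulrC -seq_avgZ.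
by apply: eq_seq_avg => s _; rewrite mulrC.
Qed.

Lemma seq_avg_exchange m t (F : seq V -> seq V -> R) :
  seq_avg t (fun u => seq_avg m (F u)) =
  seq_avg m (fun s => seq_avg t (fun u => F u s)).
Proof.
elim: t F => [//|t IHt] F /=; rewrite -avg_seq_avg.
by apply: eq_avg => v; rewrite IHt.
Qed.

Lemma seq_avg_exists m F a : a <= seq_avg m F -> exists2 s, size s = m & a <= F s.
Proof.
elim: m F => [|m IHm] F /=; first by exists [::].
by case/avg_exists => v /IHm[s sm aF]; exists (v :: s); rewrite /= ?sm.
Qed.

Lemma seq_avg_big m (g : V -> R) :
  seq_avg m (fun s => \sum_(v <- s) g v) = m%:R * avg g.
Proof.
elim: m => [|m IHm] /=; first by rewrite big_nil mul0r.
under eq_avg => v do under eq_seq_avg => s _ do rewrite big_cons.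
under eq_avg => v do rewrite seq_avgD seq_avg_const IHm.
by rewrite avgD avg_const -natr1 mulrDl mul1r addrC.
Qed.

(** Independence and mean zero make all cross terms vanish. *)
Lemma second_moment m (g : V -> R) : avg g = 0 ->
  seq_avg m (fun s => (\sum_(v <- s) g v) ^+ 2) = m%:R * avg (fun v => g v ^+ 2).
Proof.
move=> g0; elim: m => [|m IHm] /=; first by rewrite big_nil expr0n mul0r.
rewrite -natr1 mulrDl mul1r -IHm addrC -[X in _ = _ + X]avg_const -avgD.
apply: eq_avg => v.
transitivity (seq_avg m (fun s => g v ^+ 2 + (g v *+ 2 * \sum_(v <- s) g v +
    (\sum_(v <- s) g v) ^+ 2))).
  by apply: eq_seq_avg => s _; rewrite big_cons; ring.
by rewrite !seq_avgD seq_avg_const seq_avgZ seq_avg_big g0 !mulr0 add0r.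
Qed.

(** [B v] is invariant under permutations of the sample, so after exchanging averages each of the
    [m.+1] positions contributes as much as the first. *)
Lemma seq_avg_symmetric m (B : V -> seq V -> R) :
  (forall v s s', perm_eq s s' -> B v s = B v s') ->
  seq_avg m.+1 (fun s => \sum_(v <- s) B v s) =
    m.+1%:R * avg (fun v => seq_avg m (fun s => B v (v :: s))).
Proof.
elim: m B => [|m IHm] B Bperm.
  by rewrite mul1r /=; apply: eq_avg => v; rewrite big_seq1.
rewrite [LHS]seq_avgS.
transitivity (avg (fun v => seq_avg m.+1 (fun s => B v (v :: s)) +
    seq_avg m.+1 (fun s => \sum_(w <- s) B w (v :: s)))).
  by apply: eq_avg => v; rewrite -seq_avgD; apply: eq_seq_avg => s _; rewrite big_cons.
rewrite avgD -natr1 mulrDl mul1r addrC; congr (_ + _).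
transitivity (avg (fun v => m.+1%:R * avg (fun w => seq_avg m (fun s => B w [:: v, w & s])))).
  apply: eq_avg => v; rewrite (IHm (fun w s => B w (v :: s))) //.
  by move=> w s s' ss'; apply: Bperm; rewrite perm_cons.
rewrite avgZ; congr (_ * _); rewrite {1}/avg.
under eq_bigr do rewrite /avg.
rewrite -mulr_suml exchange_big /= /avg; congr (_ / _).
rewrite mulr_suml; apply: eq_bigr => w _; congr (_ / _).
apply: eq_bigr => v _; apply: eq_seq_avg => s _; apply: Bperm.
by apply/permP => a /=; rewrite addnCA.
Qed.

(** Once [v] is fixed as the first entry, the rest of the sample is independent of it, and
    Chebyshev's inequality bounds the chance that [v] has an exceptional count. *)
Lemma sample_concentration (m : nat) (eps : R) (rho : rel V) :
  0 < eps -> 2 <= m%:R * eps ->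
  seq_avg m.+1 (fun s => (count (fun v =>
      (size s)%:R * (avg (fun x => (rho v x)%:R) + eps) < (count (rho v) s)%:R) s)%:R) <=
    m.+1%:R * (4 / (m%:R * eps ^+ 2)).
Proof.
move=> e0 me; have m0 : 0 < m%:R :> R.
  by rewrite -(pmulr_lgt0 _ e0); apply: lt_le_trans me.
pose p v := avg (fun x => (rho v x)%:R).
pose B v s : R := ((size s)%:R * (p v + eps) < (count (rho v) s)%:R)%R%:R.
have -> : seq_avg m.+1 (fun s => (count (fun v =>
      (size s)%:R * (avg (fun x => (rho v x)%:R) + eps) < (count (rho v) s)%:R) s)%:R) =
    seq_avg m.+1 (fun s => \sum_(v <- s) B v s).
  apply: eq_seq_avg => s _; rewrite -sum1_count natr_sum big_mkcond /=.
  by apply: eq_bigr => v _; rewrite /B; case: ifP.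
rewrite seq_avg_symmetric; last first.
  by move=> v s s' ss'; rewrite /B (perm_size ss') (permP ss').
rewrite ler_pM2l ?ltr0n // -(avg_const (4 / _)); apply: ler_avg => v.
have p01 : 0 <= p v <= 1.
  by rewrite avg_ge0 ?avg_le1 // => x; case: (rho v x).
pose g x : R := (rho v x)%:R - p v.
have g0 : avg g = 0 by rewrite /g avgD avg_const subrr.
have sumg s : \sum_(x <- s) g x = (count (rho v) s)%:R - (size s)%:R * p v.
  rewrite sumrB big_const_seq iter_addr_0 count_predT mulr_natl; congr (_ - _).
  rewrite -sum1_count natr_sum [RHS]big_mkcond; apply: eq_bigr => x _.
  by case: (rho v x).
have g2 : avg (fun x => g x ^+ 2) <= 1.
  apply: avg_le1 => x; rewrite /g; case/andP: p01 => p0 p1.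
  by case: (rho v x) => /=; nra.
apply: (@le_trans _ _ (seq_avg m (fun s => (4 / (m%:R * eps) ^+ 2) * (\sum_(x <- s) g x) ^+ 2))).
  apply: ler_seq_avg => s sm; rewrite /B /= sm.
  case: ltP => [bad|_]; last first.
    by rewrite mulr_ge0 ?sqr_ge0 // divr_ge0 ?sqr_ge0.
  (* [v] itself may add one to the count; [2 <= m%:R * eps] absorbs this in half of the
     deviation. *)
  have h1 : m%:R * eps / 2 <= \sum_(x <- s) g x.
    rewrite sumg sm; move: bad; rewrite natrD -natr1 => bad.
    have : (rho v v)%:R <= 1 :> R by case: (rho v v).
    case/andP: p01 => p0 p1; move: bad me; lra.
  have me0 : 0 < m%:R * eps by rewrite mulr_gt0.
  rewrite mulrAC ler_pdivlMr ?exprn_gt0 // mul1r.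
  have : (m%:R * eps / 2) ^+ 2 <= (\sum_(x <- s) g x) ^+ 2.
    by rewrite ler_sqr ?nnegrE ?(le_trans _ h1) // ltW // divr_gt0.
  by rewrite [X in X <= _]expr2; lra.
rewrite seq_avgZ second_moment //.
apply: (@le_trans _ _ (4 / (m%:R * eps) ^+ 2 * (m%:R * 1))).
  by rewrite !ler_wpM2l ?ler0n // divr_ge0 ?sqr_ge0.
rewrite le_eqVlt; apply/orP; left; apply/eqP; field.
by rewrite !gt_eqF.
Qed.

End Averages.

(** Both densities may grow by [eps] in a sample; the right-hand side is what the enlarged [u] of
    [sample_light_bottle] provides. *)
Lemma slack_absorption (R : realFieldType) (a d c q eps : R) : 0 < eps ->
  a + q * d <= c -> 0 < eps * q ->
  a + eps + q * (d + eps) <= c + 2 * eps + 2 * eps * q.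
Proof. lra. Qed.

(** * Light bottles in random samples *)

Section Sampling.
Variables (R : realType) (V : finType) (v0 : V) (e : rel V).
Hypotheses (e_sym : symmetric e) (e_irr : irreflexive e).
Variables (om sg : R) (k : nat).
Hypotheses (sg_gt0 : 0 < sg) (sg_le_om : sg <= om).

Let V_gt0 : (0 < #|V|)%N. Proof. by apply/card_gt0P; exists v0. Qed.
Let om_gt0 : 0 < om. Proof. exact: lt_le_trans sg_le_om. Qed.

Local Notation h := (k%:R * om + sg).

Let h_gt0 : 0 < h. Proof. by rewrite ltr_wpDl // mulr_ge0 // ltW. Qed.

Lemma sum_nth_ord (s : seq V) (f : V -> R) :
  \sum_(i < size s) f (nth v0 s i) = \sum_(v <- s) f v.
Proof. by rewrite (big_nth v0) big_mkord. Qed.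

Lemma card_nth_ord (s : seq V) (P : pred V) :
  #|[set i : 'I_(size s) | P (nth v0 s i)]| = count P s.
Proof.
rewrite -sum1_card -sum1_count (big_nth v0) big_mkord.
by apply: eq_bigl => i; rewrite inE.
Qed.

Lemma avg_indicator (P : pred V) : avg (fun x => (P x)%:R) = #|[set x | P x]|%:R / #|V|%:R :> R.
Proof.
rewrite /avg -sum1_card natr_sum [in RHS]big_mkcond; congr (_ / _).
by apply: eq_bigr => v _; rewrite inE; case: (P v).
Qed.

Definition nonnbr_density (v : V) : R := avg (fun x => (~~ e v x)%:R).
(** The non-neighbour density decreases with the degree, so this is the proportion of vertices whose
    degree is at most that of [v]; it stands for [i / n] in the degree condition. *)
Definition rank_density (v : V) : R :=
  avg (fun x => ((nonnbr_density v <= nonnbr_density x)%R)%:R).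

(** The bottle lives on positions of the sample rather than on vertices, so its shape [T] ranges
    over a finite set that does not depend on [V]. *)
Definition light_bottle (w : V -> R) (b : R) (m : nat)
    (T : 'I_m * {set 'I_m}) (s : seq V) : bool :=
  bottle (fun i j : 'I_m => e (nth v0 s i) (nth v0 s j)) [set: 'I_m] k T &&
  (\sum_i bottle_weight om sg T i * w (nth v0 s i) <= b).
Arguments light_bottle w b m T s : clear implicits.

Variables (eps del : R).
Hypotheses (eps_gt0 : 0 < eps) (eps_le1 : eps <= 1).
Hypothesis del_eps : (1 + eps) < (1 + del) * (1 - (2 * k.+1)%:R * eps * h / sg).
Hypothesis del_gt0 : 0 < del.

Hypothesis degrees : forall v, nonnbr_density v <= om / h + eps \/
  nonnbr_density v + sg / om * rank_density v <= (om + sg) / h.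

(** The graph on the well-behaved positions has an almost perfect fractional tiling. If all its
    bottles were heavier than the threshold, the tiling would cover more weight than the sample
    has. *)
Lemma sample_light_bottle (w : V -> R) (s : seq V) :
  (0 < size s)%N -> (forall v, 0 <= w v) -> 0 < avg w ->
  (count (fun v => (size s)%:R * (nonnbr_density v + eps) <
             (count (fun x => ~~ e v x) s)%:R) s +
   count (fun v => (size s)%:R * (rank_density v + eps) <
     (count (fun x => nonnbr_density v <= nonnbr_density x) s)%:R) s)%:R <=
     eps * (size s)%:R ->
  \sum_(v <- s) w v <= (1 + eps) * (size s)%:R * avg w ->
  exists T, light_bottle w ((1 + del) * h * avg w) (size s) T s.
Proof.
move=> s0 w0 aw0; set bad1 := fun v => _ < _; set bad2 := fun v => _ < _.
set M : R := (size s)%:R => cbad sw.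
have M0 : 0 < M by rewrite ltr0n.
pose E : rel 'I_(size s) := fun i j => e (nth v0 s i) (nth v0 s j).
have Es : symmetric E by move=> i j; rewrite /E e_sym.
have Ei : irreflexive E by move=> i; rewrite /E e_irr.
pose kap (i : 'I_(size s)) := M * (nonnbr_density (nth v0 s i) + eps).
pose A := [set i : 'I_(size s) | ~~ bad1 (nth v0 s i) && ~~ bad2 (nth v0 s i)].
(* With these values [k%:R * om * u + sg * m1] equals [(1 - eps) * M], a lower bound for [#|A|]. The
   summand [2 * eps / om] in [u] absorbs the sampling errors in [degrees], and [m2] lies just below
   [m1]. *)
pose u := M * (h^-1 + 2 * eps / om).
pose m1 := M * (h^-1 - (2 * k + 1)%:R * eps / sg).
pose m2 := M * (h^-1 - (2 * k.+1)%:R * eps / sg).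
have dens0 v : 0 <= nonnbr_density v by apply: avg_ge0 => // x.
have cA : (1 - eps) * M <= #|A|%:R.
  have : (size s <= #|A| + (count bad1 s + count bad2 s))%N.
    rewrite -{1}[size s]card_ord -!card_nth_ord.
    rewrite -(cardC A) leq_add2l; apply: leq_trans (leq_card_setU _ _).
    apply: subset_leq_card; apply/subsetP => i.
    by rewrite !inE negb_and !negbK.
  rewrite -(ler_nat R) natrD -/M; move: cbad; set q := (_ + _)%:R; lra.
have [|||i iA|i iA||y [y0 yA y1] Ym] := @almost_perfect_fractional_tiling R _ E
    Es Ei om sg sg_gt0 sg_le_om kap u m1 m2 _ _ _ k A.
- by move=> i; rewrite mulr_ge0 ?addr_ge0 // ltW.
- rewrite /m1 /m2 ltr_pM2l // ltrD2l ltrN2 ltr_pM2r ?invr_gt0 // ltr_pM2r //.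
  by rewrite ltr_nat mulnS addnC ltn_add2r.
- rewrite /m1 /u ler_pM2l // lerD2l; apply: (@le_trans _ _ 0).
    by rewrite oppr_le0 divr_ge0 ?mulr_ge0 // ltW.
  by rewrite divr_ge0 ?mulr_ge0 // ltW.
- move: iA; rewrite inE -leNgt => /andP[+ _]; apply: le_trans.
  rewrite ler_nat -card_nth_ord; apply: subset_leq_card.
  by apply/subsetP => j; rewrite !inE => /andP[].
- move: iA; rewrite inE -leNgt -leNgt => /andP[_ i2].
  have crk : #|[set j in A | (kap i <= kap j)%R]|%:R <= M * (rank_density (nth v0 s i) + eps).
    apply: le_trans i2; rewrite ler_nat -card_nth_ord; apply: subset_leq_card.
    by apply/subsetP => j; rewrite !inE /kap ler_pM2l // lerD2r => /andP[].
  have [hi|lo] := degrees (nth v0 s i); [left|right].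
    rewrite /kap /u mulrCA ler_pM2l // mulrDr [om * (_ / _)]mulrC divfK ?gt_eqF //.
    by move: hi; lra.
  apply: (@le_trans _ _ (kap i + sg / om * (M * (rank_density (nth v0 s i) + eps)))).
    by rewrite lerD2l ler_pM2l // divr_gt0.
  rewrite /kap /u mulrCA [_ * (M * _)]mulrCA -mulrDr ler_pM2l //.
  have -> : (om + sg) * (h^-1 + 2 * eps / om) =
      (om + sg) / h + 2 * eps + 2 * eps * (sg / om).
    by field; rewrite !gt_eqF.
  have : 0 < eps * (sg / om) by rewrite mulr_gt0 // divr_gt0.
  move: lo; set q := sg / om; set c := (om + sg) / h.
  move: (nonnbr_density _) (rank_density _) => a d; exact: slack_absorption.
- apply: le_trans cA; rewrite /u /m1 le_eqVlt; apply/orP; left; apply/eqP.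
  rewrite natrD natrM; field; by rewrite !gt_eqF.
have m20 : (1 + eps) * M < (1 + del) * h * m2.
  have -> : (1 + del) * h * m2 = M * ((1 + del) * (1 - (2 * k.+1)%:R * eps * h / sg)).
    by rewrite /m2; field; rewrite !gt_eqF.
  by rewrite mulrC ltr_pM2l.
pose B := (1 + del) * h * avg w.
have B0 : 0 < B by rewrite /B mulr_gt0 // mulr_gt0 // addr_gt0.
have [/existsP[T /andP[bT wT]]|noT] := boolP [exists T, bottle E [set: _] k T &&
    (\sum_i bottle_weight om sg T i * w (nth v0 s i) <= B)].
  by exists T; apply/andP.
have heavy T : B * y T <= (\sum_i bottle_weight om sg T i * w (nth v0 s i)) * y T.
  have [bT|/yA ->] := boolP (bottle E A k T); last by rewrite !mulr0.
  rewrite ler_wpM2r // ltW // ltNge; apply: contra noT => wT.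
  apply/existsP; exists T; rewrite wT andbT.
  by case/bottleP: bT => *; apply/bottleP; split=> // i; rewrite inE.
have : \sum_T B * y T <= \sum_(v <- s) w v.
  apply: le_trans (ler_sum _ (fun T _ => heavy T)) _.
  rewrite -sum_nth_ord; under eq_bigr do rewrite mulr_suml.
  rewrite exchange_big /=; apply: ler_sum => i _.
  have -> : \sum_T bottle_weight om sg T i * w (nth v0 s i) * y T =
     w (nth v0 s i) * coverage om sg y i.
    by rewrite mulr_sumr; apply: eq_bigr => T _; rewrite mulrAC mulrC.
  by rewrite ler_piMr.
rewrite -mulr_sumr leNgt => /negP[]; apply: le_lt_trans sw _.
apply: (@lt_le_trans _ _ (B * m2)); last by rewrite ler_pM2l.
by rewrite /B [X in _ < X]mulrAC ltr_pM2r.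
Qed.

(** By Markov's inequality the two counts cause failure with probability at most [eps / 8] each, and
    the total weight with probability at most [1 - eps / 2]. So a proportion of at least [eps / 4]
    of the samples has a light bottle, and some shape [T] receives its share. *)
Lemma light_bottle_density (w : V -> R) (m : nat) :
  2 <= m%:R * eps -> 32 <= m%:R * eps ^+ 4 ->
  (forall v, 0 <= w v) -> 0 < avg w ->
  exists T, eps / 4 / #|{: 'I_m.+1 * {set 'I_m.+1}}|%:R <=
    seq_avg m.+1
      (fun s => (light_bottle w ((1 + del) * h * avg w) m.+1 T s)%:R).
Proof.
move=> m1 m2 w0 aw0; set b := (1 + del) * h * avg w.
set N := #|_|; have N0 : (0 < N)%N by apply/card_gt0P; exists (ord0, set0).
apply/existsP; apply: contraT; rewrite negb_exists => /forallP small.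
pose bad1 s v := (size s)%:R * (nonnbr_density v + eps) <
   (count (fun x => ~~ e v x) s)%:R.
pose bad2 s v := (size s)%:R * (rank_density v + eps) <
   (count (fun x => nonnbr_density v <= nonnbr_density x) s)%:R.
pose M : R := m.+1%:R; have M0 : 0 < M by rewrite ltr0n.
(* The subtracted terms add up to at least one as soon as a requirement fails, so the left-hand side
   is at most zero unless the sample contains a light bottle. *)
have pw s : size s = m.+1 ->
    1 - ((eps * M)^-1 * (count (bad1 s) s)%:R + (eps * M)^-1 * (count (bad2 s) s)%:R +
         ((1 + eps) * M * avg w)^-1 * \sum_(v <- s) w v) <=
    \sum_T (light_bottle w b m.+1 T s)%:R.
  move=> sm.
  have t1 : 0 <= (eps * M)^-1 * (count (bad1 s) s)%:R +
      (eps * M)^-1 * (count (bad2 s) s)%:R.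
    by rewrite addr_ge0 // mulr_ge0 ?invr_ge0 // mulr_ge0 // ltW.
  have K0 : 0 < (1 + eps) * M * avg w by rewrite mulr_gt0 // mulr_gt0 // addr_gt0.
  have t2 : 0 <= ((1 + eps) * M * avg w)^-1 * \sum_(v <- s) w v.
    by rewrite mulr_ge0 ?invr_ge0 ?sumr_ge0 // ltW.
  have s0 : 0 <= \sum_T (light_bottle w b m.+1 T s)%:R :> R by apply: sumr_ge0.
  have [c1|c1] := leP ((count (bad1 s) s + count (bad2 s) s)%:R : R) (eps * M); last first.
    apply: le_trans s0; rewrite subr_le0 -[X in X <= _]addr0; apply: lerD => //.
    rewrite -mulrDr -natrD mulrC ler_pdivlMr ?mul1r ?mulr_gt0 //; exact: ltW.
  have [c2|c2] := leP (\sum_(v <- s) w v) ((1 + eps) * M * avg w); last first.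
    apply: le_trans s0; rewrite subr_le0 -[X in X <= _]add0r; apply: lerD => //.
    by rewrite mulrC ler_pdivlMr // mul1r ltW.
  apply: (@le_trans _ _ 1); first by rewrite gerBl addr_ge0.
  have sM : (size s)%:R = M by rewrite sm.
  have s_gt0 : (0 < size s)%N by rewrite sm.
  rewrite -sM in c1 c2.
  have := sample_light_bottle s_gt0 w0 aw0 c1 c2; rewrite sm => -[T lT].
  by rewrite (bigD1 T) //= lT lerDl sumr_ge0.
have := ler_seq_avg pw; rewrite seq_avg_sum leNgt.
suff -> : \sum_T seq_avg m.+1 (fun s => (light_bottle w b m.+1 T s)%:R) <
    seq_avg m.+1 (fun s => 1 - ((eps * M)^-1 * (count (bad1 s) s)%:R +
      (eps * M)^-1 * (count (bad2 s) s)%:R +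
         ((1 + eps) * M * avg w)^-1 * \sum_(v <- s) w v)) by [].
apply: (@lt_le_trans _ _ (eps / 4)).
  have -> : eps / 4 = \sum_(T : 'I_m.+1 * {set 'I_m.+1}) (eps / 4 / N%:R).
    by rewrite sumr_const -[RHS]mulr_natr -/N mulfVK // pnatr_eq0 -lt0n.
  apply: ltr_sum => [|T _]; last by rewrite ltNge small.
  by apply/hasP; exists (ord0, set0); rewrite ?mem_index_enum.
have -> : seq_avg m.+1 (fun s => 1 - ((eps * M)^-1 * (count (bad1 s) s)%:R +
      (eps * M)^-1 * (count (bad2 s) s)%:R +
         ((1 + eps) * M * avg w)^-1 * \sum_(v <- s) w v)) =
   1 - ((eps * M)^-1 * seq_avg m.+1 (fun s => (count (bad1 s) s)%:R) +
      (eps * M)^-1 * seq_avg m.+1 (fun s => (count (bad2 s) s)%:R) +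
         ((1 + eps) * M * avg w)^-1 * (M * avg w)).
  rewrite -(seq_avg_big V_gt0) -!seq_avgZ -!seq_avgD.
  rewrite -[X in X - _](@seq_avg_const R V V_gt0 m.+1) -mulN1r -seq_avgZ -seq_avgD.
  by apply: eq_seq_avg => s _; rewrite mulN1r.
have b1 := sample_concentration V_gt0 (fun v x => ~~ e v x) eps_gt0 m1.
have b2 := sample_concentration V_gt0 (fun v x => nonnbr_density v <= nonnbr_density x) eps_gt0 m1.
have m0 : 0 < m%:R :> R.
  by rewrite -(pmulr_lgt0 _ eps_gt0); apply: lt_le_trans m1.
have b3 : M * (4 / (m%:R * eps ^+ 2)) <= eps * M * (eps / 8).
  rewrite [eps * M]mulrC -mulrA ler_pM2l // ler_pdivrMr ?mulr_gt0 ?exprn_gt0 //.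
  by move: m2; rewrite !exprS expr0; lra.
have c1 s1 : s1 <= M * (4 / (m%:R * eps ^+ 2)) -> (eps * M)^-1 * s1 <= eps / 8.
  by move=> h1; rewrite mulrC ler_pdivrMr ?mulr_gt0 // mulrC (le_trans h1).
have c2 : ((1 + eps) * M * avg w)^-1 * (M * avg w) <= 1 - eps / 2.
  have -> : ((1 + eps) * M * avg w)^-1 * (M * avg w) = (1 + eps)^-1.
    by field; rewrite !gt_eqF // addr_gt0.
  rewrite -div1r ler_pdivrMr ?addr_gt0 //.
  have : 0 <= eps * (1 - eps) by rewrite mulr_ge0 ?subr_ge0 // ltW.
  by lra.
apply: (@le_trans _ _ (1 - (eps / 8 + eps / 8 + (1 - eps / 2)))); first by lra.
by rewrite lerD2l lerN2 !lerD //; apply: c1; [exact: b1|exact: b2].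
Qed.

End Sampling.

(** * Blow-ups of bottles *)

Section BlowUp.
Variable R : realType.

Lemma seq_avg_all (V : finType) (t : nat) (Q : pred V) :
  seq_avg t (fun Y => (all Q Y)%:R) = avg (fun v => (Q v)%:R) ^+ t :> R.
Proof.
elim: t => [|t IHt]; first by rewrite expr0.
rewrite seq_avgS exprS -IHt mulrC -avgZ; apply: eq_avg => v.
rewrite mulrC -seq_avgZ; apply: eq_seq_avg => Y _ /=.
by rewrite -natrM mulnb.
Qed.

Lemma seq_avg_repeat (V : finType) (t : nat) : (0 < #|V|)%N ->
  seq_avg t (fun Y : seq V => (~~ uniq Y)%:R) <= (t ^ 2)%:R / #|V|%:R :> R.
Proof.
move=> V0; elim: t => [|t IHt] /=; first by rewrite mul0r.
have hv v : seq_avg t (fun s : seq V => (~~ ((v \notin s) && uniq s))%:R) <=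
    seq_avg t (fun s : seq V => (v \in s)%:R) + (t ^ 2)%:R / #|V|%:R :> R.
  apply: le_trans (lerD (lexx _) IHt); rewrite -seq_avgD; apply: ler_seq_avg.
  by move=> s _; rewrite -natrD ler_nat negb_and negbK; case: (v \in s); case: (uniq s).
apply: le_trans (ler_avg hv) _; rewrite avgD avg_const // avg_seq_avg.
have -> : (t.+1 ^ 2)%:R / #|V|%:R =
    t.*2.+1%:R / #|V|%:R + (t ^ 2)%:R / #|V|%:R :> R.
  by rewrite -mulrDl -natrD; congr (_%:R / _); lia.
rewrite lerD2r; apply: (@le_trans _ _ (seq_avg t (fun=> t%:R / #|V|%:R : R))).
  apply: ler_seq_avg => s st; rewrite /avg ler_wpM2r ?invr_ge0 //.
  rewrite -natr_sum ler_nat -st; apply: leq_trans (card_size s).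
  by rewrite -sum1_card [X in (_ <= X)%N]big_mkcond; apply: leq_sum => v _; case: (v \in s).
by rewrite seq_avg_const // ler_wpM2r ?invr_ge0 // ler_nat; lia.
Qed.

(* Erdos' theorem on complete m-partite m-uniform hypergraphs. *)
Lemma dense_contains_blowup (m t : nat) (c : R) : 0 < c ->
  exists n0 : nat, forall (V : finType), (n0 <= #|V|)%N ->
  forall P : pred (seq V), c <= seq_avg m (fun s => (P s)%:R) ->
  exists Ys : seq (seq V), [/\ size Ys = m,
    all (fun Y => uniq Y && (size Y == t)) Ys &
    forall s, all2 (fun v (Y : seq V) => v \in Y) s Ys -> P s].
Proof.
elim: m c => [|m IHm] c c0.
  exists 0%N => V _ P /= cP; exists [::]; split=> // -[|//] _.
  by move: cP; case: (P [::]) => //; rewrite leNgt c0.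
pose c' := (c / 2) ^+ t * (c / 2).
have c20 : 0 < c / 2 by rewrite divr_gt0.
have c'0 : 0 < c' by rewrite mulr_gt0 ?exprn_gt0.
have [n1 hn1] := IHm (c' / 2) (divr_gt0 c'0 (ltr0Sn _ 1)).
pose n2 := Num.bound (2 * (t ^ 2)%:R / c').
exists (maxn n1 n2.+1) => V; rewrite geq_max => /andP[/hn1 hV n2V] P cP.
have V0 : (0 < #|V|)%N by apply: leq_trans n2V.
have tV : (t ^ 2)%:R / #|V|%:R <= c' / 2.
  have : 2 * (t ^ 2)%:R / c' <= #|V|%:R.
    apply: ltW; apply: lt_le_trans (_ : n2%:R <= _); last by rewrite ler_nat ltnW.
    by apply: archi_boundP; apply: divr_ge0; [exact: mulr_ge0|exact: ltW].
  by rewrite !ler_pdivrMr ?ltr0n //; lra.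
pose a s : R := avg (fun v => (P (v :: s))%:R).
pose G Y : R := seq_avg m (fun s => (all (fun v => P (v :: s)) Y)%:R).
have aP : c <= seq_avg m a by rewrite -avg_seq_avg.
have a01 s : 0 <= a s <= 1.
  by rewrite avg_ge0 ?avg_le1 // => v; case: (P _).
have Gc : c' <= seq_avg t G.
  rewrite /G seq_avg_exchange; under eq_seq_avg do rewrite seq_avg_all.
  (* This replaces convexity by the bound [a ^+ t >= (c / 2) ^+ t * (a - c / 2)] on the unit
     interval, whose right-hand side is not positive for [a <= c / 2]. *)
  apply: (@le_trans _ _ (seq_avg m (fun s => (c / 2) ^+ t * (a s + - (c / 2))))).
    rewrite seq_avgZ seq_avgD seq_avg_const // ler_pM2l ?exprn_gt0 //.
    by move: aP; lra.
  apply: ler_seq_avg => s _; case/andP: (a01 s) => a0 a1; rewrite -/(a s).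
  have [ac|/ltW ca] := leP (a s) (c / 2).
    by apply: (@le_trans _ _ 0); rewrite ?exprn_ge0 // pmulr_rle0 ?exprn_gt0 // subr_le0.
  apply: (@le_trans _ _ ((c / 2) ^+ t * 1)).
    by rewrite ler_pM2l ?exprn_gt0 //; move: c20; lra.
  by rewrite mulr1 lerXn2r // ?nnegrE // ltW.
(* A repetition in [Y] is charged one unit, which [G] never exceeds, so a choice of positive value
   has distinct entries. *)
have : c' / 2 <= seq_avg t (fun Y => G Y + -1 * (~~ uniq Y)%:R).
  rewrite seq_avgD seq_avgZ mulN1r.
  by have := seq_avg_repeat t V0; move: tV Gc; lra.
case/seq_avg_exists => // Y Yt GY.
have Yu : uniq Y.
  move: GY; case: (uniq Y) => //=; rewrite mulr1 leNgt => /negP[].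
  apply: (@le_lt_trans _ _ 0); last by rewrite divr_gt0.
  rewrite subr_le0 -(seq_avg_const V0 m 1); apply: ler_seq_avg => s _.
  by case: (all _ _).
move: GY; rewrite Yu /= mulr0 addr0 => /hV[Ys [Ysm Ysu YsP]].
exists (Y :: Ys); split=> /=; [by rewrite Ysm|by rewrite Yu Yt eqxx|].
by move=> [//|v s] /= /andP[vY /YsP/allP/(_ _ vY)].
Qed.

(** Put the small class on the heaviest part [M] and rotate the other classes cyclically over the
    remaining parts; some rotation is no heavier than the average one. The average is compared with
    the bottle weights through [a p0 <= sg], [sg <= om] and the maximality of [W M]. *)
Lemma good_arrangement (k : nat) (om sg : R) (a W : 'I_k.+2 -> R) p0 :
  sg <= om -> a p0 <= sg -> \sum_p a p = k.+1%:R * om + sg ->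
  exists2 pi : 'I_k.+2 -> 'I_k.+2, injective pi &
    \sum_p a p * W (pi p) <= sg * W ord0 + om * \sum_(j < k.+1) W (lift ord0 j).
Proof.
move=> so a0 asum.
case: (@arg_maxP _ _ _ (ord0 : 'I_k.+2) xpredT W isT) => M _ Mmax.
pose S := \sum_(j < k.+1) W (lift M j).
(* Addition in ['I_k.+1] is cyclic, so [c] ranges over the rotations. *)
pose pi c p := if unlift p0 p is Some j then lift M (j + c) else M.
have sum_split (F : 'I_k.+2 -> R) q : \sum_p F p = F q + \sum_(j < k.+1) F (lift q j).
  by rewrite (bigD1_ord q).
have pi_inj c : injective (pi c).
  move=> p q; rewrite /pi; case: unliftP => [j ->|->]; case: unliftP => [l ->|->] //.
  - by move=> /lift_inj/addIr ->.
  - by move=> h; have := neq_lift M (j + c); rewrite h eqxx.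
  - by move=> h; have := neq_lift M (l + c); rewrite -h eqxx.
pose f c := \sum_p a p * W (pi c p).
have fE c : f c = a p0 * W M + \sum_j a (lift p0 j) * W (lift M (j + c)).
  rewrite /f (sum_split _ p0) /pi unlift_none; congr (_ + _).
  by apply: eq_bigr => j _; rewrite liftK.
have sumf : \sum_c f c = k.+1%:R * (a p0 * W M) + (k.+1%:R * om + sg - a p0) * S.
  under eq_bigr do rewrite fE.
  rewrite big_split /= sumr_const card_ord -[a p0 * W M *+ _]mulr_natl; congr (_ + _).
  have -> : k.+1%:R * om + sg - a p0 = \sum_j a (lift p0 j).
    by rewrite -asum (sum_split a p0) addrAC subrr add0r.
  rewrite exchange_big /= mulr_suml.
  apply: eq_bigr => j _; rewrite -mulr_sumr; congr (_ * _).
  by rewrite [RHS](reindex_inj (addrI j)).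
have [c hc] : exists c, f c <= a p0 * W M + (k.+1%:R * om + sg - a p0) * S / k.+1%:R.
  have [||c] := @avg_exists R 'I_k.+1 _ (fun c => - f c)
      (- (a p0 * W M + (k.+1%:R * om + sg - a p0) * S / k.+1%:R)).
  - by rewrite card_ord.
  - rewrite /avg sumrN sumf card_ord mulNr lerN2 le_eqVlt; apply/orP; left.
    by apply/eqP; field; rewrite nat1r pnatr_eq0.
  - by rewrite lerN2; exists c.
exists (pi c); first exact: pi_inj.
apply: le_trans hc _.
have S_le : S <= k.+1%:R * W M.
  have -> : k.+1%:R * W M = \sum_(j < k.+1) W M by rewrite sumr_const card_ord mulr_natl.
  by apply: ler_sum => j _; exact: Mmax.
have E : W M + S = W ord0 + \sum_(j < k.+1) W (lift ord0 j).
  by rewrite -!sum_split.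
have W0M : W ord0 <= W M by apply: Mmax.
move: E S_le; set S0 := \sum_(j < _) _ => E S_le.
have h1 : (sg - a p0) * (S / k.+1%:R) <= (sg - a p0) * W M.
  by rewrite ler_wpM2l ?subr_ge0 // ler_pdivrMr ?ltr0n // mulrC.
have h2 : (om - sg) * W ord0 <= (om - sg) * W M by rewrite ler_wpM2l ?subr_ge0.
have -> : (k.+1%:R * om + sg - a p0) * S / k.+1%:R =
    om * S + (sg - a p0) * (S / k.+1%:R).
  by field; rewrite nat1r pnatr_eq0.
have ES : S = W ord0 + S0 - W M by rewrite -E addrAC subrr add0r.
rewrite [in om * S]ES; move: h1 h2; move: (_ * (S / _)) => q; lra.
Qed.

End BlowUp.

(** * From blow-ups of bottles to light blow-ups of the tiled graph *)

Section Blocks.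
Variables (R : realType) (V : finType) (v0 : V) (e : rel V).
Hypotheses (e_sym : symmetric e) (e_irr : irreflexive e).
Variables (om sg : R).

Lemma all2_mkseq (f : nat -> V) (Ys : seq (seq V)) :
  (forall i, (i < size Ys)%N -> f i \in nth [::] Ys i) ->
  all2 (fun v (Y : seq V) => v \in Y) (mkseq f (size Ys)) Ys.
Proof.
elim: Ys f => [//|Y Ys IH] f fY /=; rewrite (fY 0%N) //= (iotaDl 1) -map_comp.
by apply: (IH (fun i => f i.+1)) => i iY; apply: (fY i.+1).
Qed.

Lemma sum_enum_val_cast (I : finType) (A : {set I}) k (cA : k = #|A|) (F : I -> R) :
  \sum_(j < k) F (enum_val (cast_ord cA j)) = \sum_(i in A) F i.
Proof.
by subst k; rewrite [RHS]big_enum_val /=; under eq_bigr do rewrite cast_ord_id.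
Qed.

(** Two vertices in different parts lie on a common transversal, which yields the edge between them.
    The transversal of heaviest vertices yields the weight bound, with [W p] the maximum of [w] on
    part [p]. *)
Lemma blowup_parts k (w : V -> R) (b : R) (m t : nat) (T : 'I_m * {set 'I_m})
    (Ys : seq (seq V)) : (0 < t)%N -> size Ys = m ->
  all (fun Y => uniq Y && (size Y == t)) Ys ->
  (forall s, all2 (fun v (Y : seq V) => v \in Y) s Ys ->
     light_bottle v0 e om sg k w b T s) ->
  exists (P : 'I_k.+1 -> seq V) (W : 'I_k.+1 -> R),
    [/\ forall p, uniq (P p) /\ size (P p) = t,
        forall p q, p != q -> {in P p & P q, forall v v', e v v'},
        forall p, {in P p, forall v, w v <= W p} &
        sg * W ord0 + om * \sum_(j < k) W (lift ord0 j) <= b].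
Proof.
move=> t0 sY uY hT.
pose Y i := nth [::] Ys i.
have Yprop i : (i < m)%N -> uniq (Y i) /\ size (Y i) = t.
  by rewrite -sY => iY; have /andP[? /eqP] := allP uY _ (mem_nth [::] iY).
pose mx i := [arg max_(v > head v0 (Y i) | v \in Y i) w v]%O.
have mxP i : (i < m)%N -> mx i \in Y i /\ {in Y i, forall v, w v <= w (mx i)}.
  move=> im; rewrite /mx; case: arg_maxP => [|v vY vmax]; last by split.
  have [_] := Yprop i im; case: (Y i) => [E|a l _]; last by rewrite inE eqxx.
  by move: t0; rewrite -E.
have hf f : (forall i, (i < m)%N -> f i \in Y i) -> light_bottle v0 e om sg k w b T (mkseq f m).
  by move=> fY; apply: hT; rewrite -sY; apply: all2_mkseq => i; rewrite sY; exact: fY.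
have /andP[/bottleP[_ _ tW WW cW] wT] : light_bottle v0 e om sg k w b T (mkseq mx m).
  by apply: hf => i /mxP[].
have nbr (i j : 'I_m) v v' : i != j -> i \in T.1 |: T.2 -> j \in T.1 |: T.2 ->
    v \in Y i -> v' \in Y j -> e v v'.
  move=> ij iT jT vi vj.
  have ijn : (val j == val i) = false by rewrite (inj_eq val_inj) eq_sym (negbTE ij).
  pose f l := if l == val i then v else if l == val j then v' else mx l.
  have /andP[/bottleP[_ _ tW' WW' _] _] : light_bottle v0 e om sg k w b T (mkseq f m).
    apply: hf => l lm; rewrite /f; case: eqP => [-> //|_]; case: eqP => [-> //|_].
    by case: (mxP l lm).
  have fi : nth v0 (mkseq f m) i = v by rewrite nth_mkseq // /f eqxx.
  have fj : nth v0 (mkseq f m) j = v' by rewrite nth_mkseq // /f ijn eqxx.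
  rewrite -fi -fj; case/setU1P: iT jT ij => [->|iW] /setU1P[->|jW] ij.
  - by rewrite eqxx in ij.
  - exact: tW'.
  - by rewrite e_sym; exact: tW'.
  - exact: WW'.
have T1 : T.1 \notin T.2 by apply/negP => /tW; rewrite e_irr.
have cW' : k = #|T.2| by [].
(* Part 0 belongs to the neck of [T]; the others enumerate its wide vertices. *)
pose pos (p : 'I_k.+1) :=
  if unlift ord0 p is Some j then enum_val (cast_ord cW' j) else T.1.
have posT p : pos p \in T.1 |: T.2.
  rewrite /pos; case: unliftP => [j _|_]; last by rewrite setU11.
  by rewrite inE enum_valP orbT.
have pos_inj : injective pos.
  move=> p q; rewrite /pos; case: unliftP => [j ->|->]; case: unliftP => [l ->|->] //.
  - by move=> /enum_val_inj/cast_ord_inj ->.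
  - by move=> E; case/negP: T1; rewrite -E enum_valP.
  - by move=> E; case/negP: T1; rewrite E enum_valP.
exists (fun p => Y (pos p)), (fun p => w (mx (pos p))); split=> [p|p q pq v v'|p|].
- exact: Yprop.
- by apply: nbr; rewrite ?(inj_eq pos_inj).
- by move=> v; case: (mxP (pos p) (ltn_ord _)) => _; exact.
apply: le_trans wT; rewrite le_eqVlt; apply/orP; left; apply/eqP.
under [RHS]eq_bigr => i _ do rewrite nth_mkseq // mulrDl -!mulrA.
rewrite big_split /= -!mulr_sumr; congr (_ * _ + _ * _).
  rewrite (bigD1 T.1) //= eqxx mul1r big1 ?addr0 /pos ?unlift_none // => i /negbTE ->.
  by rewrite mul0r.
transitivity (\sum_(i in T.2) w (mx i)).
  rewrite -(sum_enum_val_cast cW'); apply: eq_bigr => j _.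
  by rewrite /pos liftK.
by rewrite [LHS]big_mkcond; apply: eq_bigr => i _; case: ifP; rewrite ?mul1r ?mul0r.
Qed.

(** Each part has [#|H| * t] vertices, so every pair in [H * 'I_t] can use its own rank as an index
    into the part chosen for its colour. Different parts are disjoint because [e] is irreflexive,
    and [good_arrangement] applied to the sizes of the colour classes bounds the weight. *)
Lemma light_block (H : finType) (eH : rel H) (k t : nat) (col : H -> 'I_k.+2)
    (w : V -> R) (b : R) (P : 'I_k.+2 -> seq V) (W : 'I_k.+2 -> R) :
  irreflexive eH -> (forall x y, eH x y -> col x != col y) ->
  sg <= om -> (exists p0, #|[set x | col x == p0]|%:R <= sg) ->
  #|H|%:R = k.+1%:R * om + sg ->
  (forall p, uniq (P p) /\ size (P p) = (#|H| * t)%N) ->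
  (forall p q, p != q -> {in P p & P q, forall v v', e v v'}) ->
  (forall p, {in P p, forall v, w v <= W p}) ->
  sg * W ord0 + om * \sum_(j < k.+1) W (lift ord0 j) <= b ->
  exists g : H * 'I_t -> V, [/\ injective g,
    forall x y i j, eH x y -> e (g (x, i)) (g (y, j)) &
    \sum_z w (g z) <= t%:R * b].
Proof.
move=> irrH colH so [p0 cp0] cH Psz Pe PW Wb.
have [|pi pi_inj pi_le] := good_arrangement (a := fun p => #|[set x | col x == p]|%:R)
    W so cp0.
  rewrite -cH -natr_sum; congr _%:R; rewrite -sum1_card.
  rewrite (partition_big col xpredT) //=; apply: eq_bigr => p _.
  by rewrite -sum1_card; apply: eq_bigl => x; rewrite inE.
have cardHt : #|{: H * 'I_t}| = (#|H| * t)%N by rewrite card_prod card_ord.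
have szP (z : H * 'I_t) (p : 'I_k.+2) : (enum_rank z < size (P p))%N.
  by have [_ ->] := Psz p; rewrite -cardHt; exact: ltn_ord.
pose g (z : H * 'I_t) := nth v0 (P (pi (col z.1))) (enum_rank z).
have gP z : g z \in P (pi (col z.1)) by rewrite mem_nth.
exists g; split.
- move=> z z'; have [cz|cz] := eqVneq (col z.1) (col z'.1); last first.
    have := Pe _ _ _ _ _ (gP z) (gP z'); rewrite (inj_eq pi_inj) => /(_ cz).
    by move=> /[swap] ->; rewrite e_irr.
  rewrite /g cz => /eqP; rewrite nth_uniq //; last by case: (Psz (pi (col z'.1))).
  by move=> /eqP/val_inj/enum_rank_inj.
- move=> x y i j /colH cxy; apply: Pe (gP _) (gP _).
  by rewrite (inj_eq pi_inj).
apply: le_trans (_ : \sum_(z : H * 'I_t) W (pi (col z.1)) <= _).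
  by apply: ler_sum => z _; exact: PW.
rewrite (eq_bigr (fun z => W (pi (col z.1)))) // -(pair_big xpredT xpredT (fun x i => W (pi (col x)))) /=.
under eq_bigr do rewrite sumr_const card_ord -mulr_natl.
rewrite -mulr_sumr ler_wpM2l //; apply: le_trans Wb; apply: le_trans pi_le.
rewrite (partition_big col xpredT) //=; apply: ler_sum => p _.
rewrite (eq_bigr (fun=> W (pi p))) => [|x /eqP -> //].
by rewrite sumr_const cardsE -[_ *+ _]mulr_natl.
Qed.

End Blocks.

(** * Packing blow-ups *)

Section Packing.
Variable R : realFieldType.

(** For injective blocks this is the number of the first [N] blocks that contain [v]. *)
Definition load (V Z : finType) (N : nat) (gs : nat -> Z -> V) (v : V) : nat :=
  \sum_(i < N) \sum_z (gs i z == v).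

Lemma sum_fiber (V Z : finType) (g : Z -> V) (F : V -> R) :
  \sum_v F v * (\sum_z (g z == v))%:R = \sum_z F (g z).
Proof.
under eq_bigr do rewrite natr_sum mulr_sumr.
rewrite exchange_big; apply: eq_bigr => z _ /=.
rewrite (bigD1 (g z)) //= eqxx mulr1 big1 ?addr0 // => v.
by rewrite eq_sym => /negbTE ->; rewrite mulr0.
Qed.

Lemma injective_fiber (V Z : finType) (g : Z -> V) v : injective g ->
  (\sum_z (g z == v) <= 1)%N.
Proof.
move=> g_inj; have [/existsP[z /eqP <-]|none] := boolP [exists z, g z == v].
  rewrite (bigD1 z) //= eqxx big1 // => z' zz'.
  by rewrite (inj_eq g_inj) (negbTE zz').
by rewrite big1 // => z _; move/existsPn: none => /(_ z)/negbTE ->.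
Qed.

Lemma sum_load (V Z : finType) N (gs : nat -> Z -> V) :
  \sum_v (load N gs v)%:R = (#|Z| * N)%:R :> R.
Proof.
rewrite -natr_sum; congr _%:R; rewrite exchange_big /=.
transitivity (\sum_(i < N) #|Z|); last by rewrite sum_nat_const card_ord mulnC.
apply: eq_bigr => i _; rewrite exchange_big /= -sum1_card; apply: eq_bigr => z _.
rewrite (bigD1 (gs i z)) //= eqxx big1 // => v.
by rewrite eq_sym => /negbTE ->.
Qed.

(* Choosing every new block to be light for the weights load + 1 keeps the
   second moment of the load close to the square of its mean. *)
Lemma balanced_blocks (V Z : finType) (Pr : (Z -> V) -> Prop) (eps : R) :
  0 <= eps -> eps <= 1 / 2 -> (0 < #|V|)%N ->
  (forall w : V -> R, (forall v, 0 <= w v) -> 0 < avg w ->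
     exists g, [/\ Pr g, injective g & \sum_z w (g z) <= (1 + eps) * #|Z|%:R * avg w]) ->
  forall N, exists2 gs : nat -> Z -> V,
    forall i, (i < N)%N -> Pr (gs i) /\ injective (gs i) &
    \sum_v (load N gs v)%:R ^+ 2 <=
      (1 + eps) * (#|Z| * N)%:R ^+ 2 / #|V|%:R + 2 * (#|Z| * N)%:R.
Proof.
move=> e0 e1 V0 light; elim=> [|N [gs gsP IH]].
  (* The constant weight only supplies a default value for the empty sequence of blocks. *)
  have [||g [Pg gi _]] := light (fun=> 1); rewrite ?avg_const ?ler01 //.
  exists (fun=> g) => //; rewrite big1 => [|v _]; last by rewrite /load big_ord0 expr0n.
  by rewrite !muln0 expr0n mulr0 mul0r mulr0 addr0.
pose l v : R := (load N gs v)%:R; pose z : R := #|Z|%:R; pose n : R := #|V|%:R.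
have n0 : 0 < n by rewrite ltr0n.
have avgl : avg (fun v => l v + 1) = z * N%:R / n + 1.
  by rewrite avgD avg_const // /avg sum_load natrM.
have [||g [Pg gi gl]] := light (fun v => l v + 1).
- by move=> v; rewrite addr_ge0.
- by rewrite avgl ltr_wpDl // divr_ge0 ?mulr_ge0 // ltW.
pose gs' i := if (i < N)%N then gs i else g.
have loadS v : load N.+1 gs' v = (load N gs v + \sum_z (g z == v))%N.
  rewrite /load big_ord_recr /= {2}/gs' ltnn; congr (_ + _)%N.
  by apply: eq_bigr => i _; rewrite /gs' ltn_ord.
exists gs' => [i iN|].
  by rewrite /gs'; case: ltnP => [/gsP//|_].
pose d v : R := (\sum_z (g z == v))%:R.
(* An injective block meets a vertex at most once, so [d] takes the values 0 and 1, and the new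
   squared load is [l v ^+ 2 + 2 * l v * d v + d v]. *)
have d2 v : d v ^+ 2 = d v.
  by rewrite /d; have := injective_fiber v gi; case: (\sum_z _)%N => [|[|]] // _;
    rewrite ?expr0n ?expr1n.
have -> : \sum_v (load N.+1 gs' v)%:R ^+ 2 =
    \sum_v l v ^+ 2 + (\sum_v (2 * l v) * d v + \sum_v 1 * d v).
  rewrite -!big_split; apply: eq_bigr => v _ /=.
  rewrite loadS natrD -/(l v) -/(d v).
  by transitivity (l v ^+ 2 + 2 * l v * d v + d v ^+ 2); last rewrite d2; ring.
rewrite !sum_fiber sumr_const -mulr_sumr.
have gl' : \sum_z l (g z) <= (1 + eps) * z * (z * N%:R / n) + eps * z.
  move: gl; rewrite avgl big_split /= sumr_const -/z; lra.
rewrite !natrM -[N.+1%:R]natr1 -/z -/n.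
have -> : (1 + eps) * (z * (N%:R + 1)) ^+ 2 / n + 2 * (z * (N%:R + 1)) =
   ((1 + eps) * (z * N%:R) ^+ 2 / n + 2 * (z * N%:R)) +
   (2 * ((1 + eps) * z * (z * N%:R / n)) + (1 + eps) * (z ^+ 2 / n) + 2 * z).
  by field; rewrite gt_eqF.
apply: lerD; first by move: IH; rewrite natrM.
have : 0 <= (1 + eps) * (z ^+ 2 / n).
  by rewrite mulr_ge0 ?addr_ge0 // divr_ge0 ?sqr_ge0 // ltW.
have : 0 <= z * (1 / 2 - eps) by rewrite mulr_ge0 ?subr_ge0.
move: gl'; lra.
Qed.

(* Assign the vertices one after another; a uniformly random choice would
   increase the sum of the squared deviations by less than one on average. *)
Lemma rounding (V J : finType) (C : V -> {set J}) :
  exists2 phi : V -> option J, forall v j, phi v = Some j -> j \in C v &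
    \sum_j (#|[set v | phi v == Some j]|%:R -
            \sum_(v | j \in C v) #|C v|%:R^-1) ^+ 2 <= #|V|%:R :> R.
Proof.
pose p v j : R := (j \in C v)%:R / #|C v|%:R.
pose D s phi j : R := \sum_(v <- s) ((phi v == Some j)%:R - p v j).
have key s : uniq s -> exists2 phi : V -> option J,
    forall v j, phi v = Some j -> j \in C v & \sum_j D s phi j ^+ 2 <= (size s)%:R.
  elim: s => [_|v s IHs /= /andP[vs us]].
    exists (fun=> None) => //.
    by rewrite big1 // => j _; rewrite /D big_nil expr0n.
  have [phi phiC phiD] := IHs us.
  pose upd o x := if x == v then o else phi x.
  have Dupd o j : D (v :: s) (upd o) j = (o == Some j)%:R - p v j + D s phi j.
    rewrite /D big_cons /upd eqxx; congr (_ + _); apply: eq_big_seq => x xs.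
    by case: (x =P v) => // xv; rewrite -xv xs in vs.
  have [C0|[j1 j1C]] := set_0Vmem (C v).
    exists (upd None) => [x j|].
      by rewrite /upd; case: eqP => // _; exact: phiC.
    apply: le_trans (le_trans phiD _); last by rewrite ler_nat.
    rewrite le_eqVlt; apply/orP; left; apply/eqP; apply: eq_bigr => j _.
    by rewrite Dupd /p C0 inE mul0r subr0 add0r.
  pose L : R := #|C v|%:R.
  have L0 : 0 < L by rewrite ltr0n card_gt0; apply/set0Pn; exists j1.
  have [j0 j0C j0le] : exists2 j0, j0 \in C v &
      \sum_j D (v :: s) (upd (Some j0)) j ^+ 2 <= \sum_j D s phi j ^+ 2 + 1.
    apply/exists_inP; apply: contraT; rewrite negb_exists_in => /forall_inP big.
    have : \sum_(j0 in C v) \sum_j D (v :: s) (upd (Some j0)) j ^+ 2 <=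
        L * (\sum_j D s phi j ^+ 2) + L.
      rewrite exchange_big mulr_sumr /=.
      have LE : L = \sum_j (j \in C v)%:R.
        rewrite /L -sum1_card natr_sum big_mkcond; apply: eq_bigr => j _.
        by case: (j \in _).
      rewrite [X in _ <= _ + X]LE -big_split /=.
      apply: ler_sum => j _.
      (* The random choice of [j0] has mean [p v j], so the terms linear in [D s phi j] cancel, and
         each [j] in [C v] adds [1 - 1 / L] to the sum. *)
      have -> : \sum_(j0 in C v) D (v :: s) (upd (Some j0)) j ^+ 2 =
          L * (D s phi j - p v j) ^+ 2 +
          (1 + 2 * (D s phi j - p v j)) * (j \in C v)%:R.
        rewrite -(sum_indicator_eq R (C v) j) mulr_sumr.
        have -> : L * (D s phi j - p v j) ^+ 2 =
            \sum_(j0 in C v) (D s phi j - p v j) ^+ 2.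
          by rewrite sumr_const mulr_natl.
        rewrite -big_split /=; apply: eq_bigr => j0 _; rewrite Dupd.
        have -> : (Some j0 == Some j) = (j == j0) by rewrite eq_sym.
        by case: (j == j0) => /=; ring.
      rewrite /p; case: (j \in C v) => /=; last by rewrite mul0r; lra.
      have -> : L * (D s phi j - 1 / L) ^+ 2 + (1 + 2 * (D s phi j - 1 / L)) * 1 =
          L * D s phi j ^+ 2 + 1 - 1 / L.
        by field; rewrite gt_eqF.
      by rewrite lerBlDr lerDl divr_ge0 // ltW.
    rewrite leNgt => /negP[].
    have -> : L * (\sum_j D s phi j ^+ 2) + L =
        \sum_(j0 in C v) (\sum_j D s phi j ^+ 2 + 1).
      by rewrite sumr_const -[RHS]mulr_natl mulrDr mulr1.
    apply: ltr_sum => [|j0 j0C]; last by rewrite ltNge big.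
    by apply/hasP; exists j1; rewrite ?mem_index_enum.
  exists (upd (Some j0)) => [x j|].
    by rewrite /upd; case: eqP => [-> [<-]//|_]; exact: phiC.
  by apply: le_trans j0le _; rewrite -natr1 lerD2r.
have [phi phiC phiD] := key (enum V) (enum_uniq V).
exists phi => //; move: phiD; rewrite -cardE; apply: le_trans.
rewrite le_eqVlt; apply/orP; left; apply/eqP; apply: eq_bigr => j _; congr (_ ^+ 2).
rewrite /D big_enum sumrB /=; congr (_ - _).
  rewrite -sum1_card natr_sum big_mkcond; apply: eq_bigr => v _.
  by rewrite inE; case: (_ == _).
rewrite big_mkcond; apply: eq_bigr => v _; rewrite /p.
by case: (j \in C v); rewrite ?mul1r ?mul0r.
Qed.

End Packing.

(** * From an assignment of vertices to a tiling *)

Section Assembly.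
Variable R : realFieldType.
Variables (H G : sgraph) (x0 : H) (N t : nat) (gs : nat -> H * 'I_t -> G).
Hypothesis gs_edge : forall i, (i < N)%N ->
  forall x y a b, edge x y -> edge (gs i (x, a)) (gs i (y, b)).

(** Within a block, the group assigned to each vertex of [H] is cut down to the size of the smallest
    group; equally indexed members of the groups then form a copy of [H]. The smallest group falls
    short of [beta] by at most the sum of the deviations in its block. *)
Lemma tiling_of_assignment (phi : G -> option ('I_N * H)) (beta : R) :
  (forall v j, phi v = Some j -> exists a, gs j.1 (j.2, a) = v) ->
  exists T : {set {ffun H -> G}}, is_tiling T /\
    #|~: covered T|%:R <= #|G|%:R - #|H|%:R *
      (N%:R * beta - \sum_j `| #|[set v | phi v == Some j]|%:R - beta |).
Proof.
move=> phiP; pose X j := [set v | phi v == Some j].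
pose xm (B : 'I_N) := [arg min_(x < x0) #|X (B, x)|].
pose nB B := #|X (B, xm B)|.
have nB_le B x : (nB B <= #|X (B, x)|)%N.
  by rewrite /nB /xm; case: arg_minnP => // x' _; apply.
have sum_nB : N%:R * beta - \sum_j `| #|X j|%:R - beta | <= (\sum_B nB B)%:R.
  rewrite natr_sum mulr_natl -[N in _ *+ N]card_ord -sumr_const.
  rewrite (eq_bigr (fun j => `| #|X (j.1, j.2)|%:R - beta |)) => [|[]//].
  rewrite -(pair_bigA _ (fun B x => `| #|X (B, x)|%:R - beta |)) /= -sumrB.
  apply: ler_sum => B _; rewrite /nB (bigD1 (xm B)) //=.
  set q := #|_|%:R; rewrite lerBlDr -lerBlDl; apply: (@le_trans _ _ `|q - beta|).
    by rewrite distrC ler_norm.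
  by rewrite lerDl sumr_ge0.
(* A pair consists of a block and the index of a copy in it; [#|G|] is a uniform bound for these
   indices. *)
pose valid := [set p : 'I_N * 'I_#|G| | (p.2 < nB p.1)%N].
have [valid0|[p0 p0v]] := set_0Vmem valid.
  exists set0; split.
    by apply/andP; split; apply/forall_inP => f; rewrite inE.
  have nB0 B : nB B = 0%N.
    apply/eqP; rewrite -leqn0 leqNgt; apply/negP => nB0.
    have BG : (0 < #|G|)%N by apply: leq_trans nB0 (max_card _).
    have : (B, Ordinal BG) \in valid by rewrite inE.
    by rewrite valid0 inE.
  have nS : (\sum_B nB B)%N = 0%N by apply: big1 => B _; exact: nB0.
  rewrite nS in sum_nB.
  apply: (@le_trans _ _ #|G|%:R); first by rewrite ler_nat max_card.
  by rewrite lerDl oppr_ge0; apply: mulr_ge0_le0.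
(* A default value for [nth], never reached because valid indices are below the size of every group
   of the block. *)
pose v0 : G := enum_val p0.2.
pose f (p : 'I_N * 'I_#|G|) := [ffun x => nth v0 (enum (X (p.1, x))) p.2].
have fX p x : p \in valid -> f p x \in X (p.1, x).
  rewrite inE => pv; rewrite ffunE -mem_enum; apply: mem_nth.
  by rewrite -cardE; apply: leq_trans pv (nB_le _ _).
have fphi p x : p \in valid -> phi (f p x) = Some (p.1, x).
  by move=> /(fX _ x); rewrite inE => /eqP.
have f_inj p q x y : p \in valid -> q \in valid -> f p x = f q y -> p = q /\ x = y.
  move=> pv qv E; have := fphi p x pv; rewrite E (fphi q y qv) => -[E1 E2].
  split=> //; move: E pv qv; rewrite !ffunE -E1 E2 => E; rewrite !inE => pv qv.
  case: p q E1 E pv qv => [B a] [B' a'] /= <- E pv qv; congr pair.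
  apply/val_inj/eqP; move/eqP: E; rewrite nth_uniq ?enum_uniq // -cardE.
    exact: leq_trans pv (nB_le _ _).
  exact: leq_trans qv (nB_le _ _).
exists (f @: valid); split.
  apply/andP; split.
    apply/forall_inP => _ /imsetP[p pv ->]; apply/andP; split.
      by apply/injectiveP => x y /f_inj[].
    apply/forallP => x; apply/forallP => y; apply/implyP => xy.
    have [a <-] := phiP _ _ (fphi p x pv); have [b <-] := phiP _ _ (fphi p y pv).
    exact: gs_edge.
  apply/forall_inP => _ /imsetP[p pv ->]; apply/forall_inP => _ /imsetP[q qv ->].
  apply/implyP => fpq; rewrite disjoint_subset; apply/subsetP => v /codomP[x ->]; rewrite !inE.
  apply/negP => /codomP[y] /f_inj[] // pq _.
  by rewrite pq eqxx in fpq.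
have cov_card : (#|valid| * #|H| <= #|covered (f @: valid)|)%N.
  have <- : #|setX valid [set: H]| = (#|valid| * #|H|)%N by rewrite cardsX cardsT.
  have inj : {in setX valid [set: H] &, injective (fun px => f px.1 px.2)}.
    by move=> [p x] [q y] /setXP[pv _] /setXP[qv _] /= /f_inj[] // -> ->.
  rewrite -(card_in_imset inj); apply: subset_leq_card.
  apply/subsetP => _ /imsetP[[p x] /setXP[pv _] ->] /=.
  by apply/bigcupP; exists (f p); [exact: imset_f|apply/imsetP; exists x].
have valid_card : #|valid| = \sum_B nB B.
  rewrite -sum1_card (eq_bigl (fun p : 'I_N * 'I_#|G| => true && (p.2 < nB p.1)%N)); last first.
    by move=> p; rewrite inE.
  rewrite -(pair_big_dep xpredT (fun (B : 'I_N) (a : 'I_#|G|) => (a < nB B)%N) (fun _ _ => 1%N)) /=.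
  apply: eq_bigr => B _.
  have nBG : (nB B <= #|G|)%N by exact: max_card.
  by rewrite (big_ord_narrow nBG) /= sum1_card card_ord.
have cc : #|~: covered (f @: valid)|%:R = #|G|%:R - #|covered (f @: valid)|%:R :> R.
  move: (covered _) => S; have /(congr1 (fun m => m%:R : R)) := cardsC S.
  by rewrite natrD => <-; rewrite addrAC subrr add0r.
rewrite cc lerD2l lerN2; move: cov_card; rewrite -(ler_nat R); apply: le_trans.
by rewrite valid_card natrM mulrC ler_wpM2r.
Qed.

End Assembly.

(** * Deviation estimates for balanced blocks *)

Section BalancedTiling.
Variable R : realFieldType.

(** The arithmetic-geometric mean inequality, from [(|a| - e) ^+ 2 >= 0]; it turns bounds on squares
    into bounds on absolute values. *)
Lemma abs_le_sqr (a e : R) : 0 < e -> `|a| <= (a ^+ 2 / e + e) / 2.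
Proof.
move=> e0; rewrite ler_pdivlMr // -(ler_pM2r e0) mulrDl divfK ?gt_eqF //.
by rewrite -real_normK ?num_real //; have := sqr_ge0 (`|a| - e); rewrite sqrrB; lra.
Qed.

(** [mu] is the mean load and [beta = t%:R / mu] the ideal number of vertices for a pair of a block
    and a vertex of [H]. Rounding compares the actual numbers with the sums [S j] of inverse loads,
    and the second moment compares those with [beta]; each error is at most [#|G|%:R * e1] in
    total. *)
Lemma tiling_of_balanced_blocks (H G : sgraph) (N t : nat)
    (gs : nat -> H * 'I_t -> G) (e1 e2 mu : R) :
  (0 < #|H|)%N -> (0 < #|G|)%N -> (0 < N)%N -> (0 < t)%N -> 0 < e1 ->
  (forall i, (i < N)%N -> (forall x y a b, edge x y ->
     edge (gs i (x, a)) (gs i (y, b))) /\ injective (gs i)) ->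
  mu = (#|H| * t * N)%:R / #|G|%:R ->
  \sum_v (load N gs v)%:R ^+ 2 <= ((1 + e2) * mu ^+ 2 + 2 * mu) * #|G|%:R ->
  mu <= t%:R * e1 ^+ 2 -> e2 + 2 / mu <= e1 ^+ 2 ->
  exists T : {set {ffun H -> G}}, is_tiling T /\
    #|~: covered T|%:R <= 2 * #|H|%:R * e1 * #|G|%:R.
Proof.
move=> H0 G0 N0 t0 e10 gsP muE gs2 mut mue; have [x0 _] := card_gt0P H0.
have h0 : 0 < #|H|%:R :> R by rewrite ltr0n.
have n0 : 0 < #|G|%:R :> R by rewrite ltr0n.
have N0' : 0 < N%:R :> R by rewrite ltr0n.
have t0' : 0 < t%:R :> R by rewrite ltr0n.
have mu0 : 0 < mu by rewrite muE divr_gt0 // ltr0n !muln_gt0 H0 t0 N0.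
pose C (v : G) := [set j : 'I_N * H | [exists a, gs j.1 (j.2, a) == v]].
have indC v j : (j \in C v) = (\sum_a (gs j.1 (j.2, a) == v))%N :> nat.
  have [_ gi] := gsP _ (ltn_ord j.1); rewrite inE.
  have [/existsP[a /eqP <-]|none] := boolP [exists a, gs j.1 (j.2, a) == v].
    rewrite (bigD1 a) //= eqxx big1 // => b ba.
    by rewrite (inj_eq gi) xpair_eqE eqxx (negbTE ba).
  by rewrite big1 // => a _; move/existsPn: none => /(_ a)/negbTE ->.
have cardC v : #|C v| = load N gs v.
  rewrite -sum1_card big_mkcond /=.
  rewrite (eq_bigr (fun j : 'I_N * H => \sum_a (gs j.1 (j.2, a) == v))%N); last first.
    by move=> j _; rewrite -indC; case: (j \in C v).
  rewrite -(pair_bigA _ (fun (B : 'I_N) x => \sum_a (gs B (x, a) == v))%N) /=.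
  by apply: eq_bigr => B _; rewrite pair_bigA; apply: eq_bigr => -[x a] _.
have colC j : \sum_(v | j \in C v) (1 : R) = t%:R.
  rewrite big_mkcond (eq_bigr (fun v => (\sum_a (gs j.1 (j.2, a) == v))%:R)); last first.
    by move=> v _; rewrite -indC; case: (j \in C v).
  rewrite -natr_sum exchange_big /=; congr _%:R.
  rewrite (eq_bigr (fun=> 1%N)); first by rewrite sum1_card card_ord.
  move=> a _; rewrite (bigD1 (gs j.1 (j.2, a))) //= eqxx big1 // => v.
  by rewrite eq_sym => /negbTE ->.
have [phi phiC phiD] := rounding R C.
pose beta : R := #|G|%:R / (#|H| * N)%:R.
have [||T [Ttil Tcov]] := @tiling_of_assignment R H G x0 N t gs _ phi beta.
- by move=> i /gsP[].
- by move=> v j /phiC; rewrite inE => /existsP[a /eqP]; exists a.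
exists T; split=> //; apply: le_trans Tcov _.
pose X j : R := #|[set v | phi v == Some j]|%:R.
pose S j : R := \sum_(v | j \in C v) #|C v|%:R^-1.
have hN : #|H|%:R * (N%:R * beta) = #|G|%:R.
  by rewrite /beta natrM; field; rewrite !gt_eqF.
have betaE : beta = t%:R / mu.
  by rewrite /beta muE !natrM; field; rewrite !gt_eqF.
have s1 : \sum_j `|X j - S j| <= #|G|%:R * e1.
  apply: (@le_trans _ _ (\sum_j ((X j - S j) ^+ 2 / e1^-1 + e1^-1) / 2)).
    by apply: ler_sum => j _; apply: abs_le_sqr; rewrite invr_gt0.
  rewrite -mulr_suml big_split /= -mulr_suml sumr_const card_prod card_ord invrK.
  have : (\sum_j (X j - S j) ^+ 2) * e1 <= #|G|%:R * e1 by rewrite ler_pM2r.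
  have : e1^-1 *+ (N * #|H|) <= #|G|%:R * e1.
    rewrite -[e1^-1 *+ _]mulr_natl ler_pdivrMr // -mulrA -expr2.
    have -> : (N * #|H|)%:R = #|G|%:R * mu / t%:R.
      by rewrite muE !natrM; field; rewrite !gt_eqF.
    by rewrite -mulrA ler_pM2l // ler_pdivrMr // mulrC.
  by move: (\sum_j _) (_ *+ _) => q1 q2; lra.
(* Each [S j] has [t] summands, so exchanging sums turns the error into deviations of the loads from
   [mu]. A vertex of load zero contributes nothing before the exchange and one after it. *)
have s2 : \sum_j `|S j - beta| <= #|G|%:R * e1.
  apply: (@le_trans _ _ (\sum_v `|1 - (load N gs v)%:R / mu|)).
    apply: (@le_trans _ _ (\sum_j \sum_(v | j \in C v) `|#|C v|%:R^-1 - mu^-1|)).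
      apply: ler_sum => j _; apply: le_trans (ler_norm_sum _ _ _).
      rewrite sumrB le_eqVlt; apply/orP; left; apply/eqP; congr `|_ - _|.
      by rewrite betaE -(colC j) mulr_suml; apply: eq_bigr => v _; rewrite mul1r.
    rewrite (exchange_big_dep xpredT) //=; apply: ler_sum => v _.
    have -> : \sum_(j in C v) `|#|C v|%:R^-1 - mu^-1| =
        (load N gs v)%:R * `|(load N gs v)%:R^-1 - mu^-1|.
      by rewrite sumr_const cardC mulr_natl.
    have [->|l0] := posnP (load N gs v).
      by rewrite mul0r.
    have l0' : 0 < (load N gs v)%:R :> R by rewrite ltr0n.
    rewrite -{1}(ger0_norm (ltW l0')) -normrM mulrBr divff ?gt_eqF //.
  apply: (@le_trans _ _ (\sum_v ((1 - (load N gs v)%:R / mu) ^+ 2 / e1 + e1) / 2)).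
    by apply: ler_sum => v _; apply: abs_le_sqr.
  rewrite -mulr_suml big_split /= -mulr_suml sumr_const -[e1 *+ _]mulr_natl.
  have -> : \sum_v (1 - (load N gs v)%:R / mu) ^+ 2 =
      #|G|%:R - 2 / mu * \sum_v (load N gs v)%:R +
      (\sum_v (load N gs v)%:R ^+ 2) / mu ^+ 2.
    rewrite mulr_sumr mulr_suml -sumr_const -sumrB -big_split; apply: eq_bigr => v _ /=.
    by field; rewrite gt_eqF.
  rewrite sum_load card_prod card_ord.
  have -> : (#|H| * t * N)%:R = mu * #|G|%:R by rewrite muE divfK ?gt_eqF.
  have q : #|G|%:R - 2 / mu * (mu * #|G|%:R) +
      (\sum_v (load N gs v)%:R ^+ 2) / mu ^+ 2 <= #|G|%:R * e1 ^+ 2.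
    have : (\sum_v (load N gs v)%:R ^+ 2) / mu ^+ 2 <=
        ((1 + e2) * mu ^+ 2 + 2 * mu) * #|G|%:R / mu ^+ 2.
      by rewrite ler_pM2r // invr_gt0 exprn_gt0.
    have -> : ((1 + e2) * mu ^+ 2 + 2 * mu) * #|G|%:R / mu ^+ 2 =
       #|G|%:R + #|G|%:R * (e2 + 2 / mu) by field; rewrite gt_eqF.
    have -> : 2 / mu * (mu * #|G|%:R) = 2 * #|G|%:R by field; rewrite gt_eqF.
    have : #|G|%:R * (e2 + 2 / mu) <= #|G|%:R * e1 ^+ 2 by rewrite ler_pM2l.
    by move: (_ * (e2 + _)) (_ / mu ^+ 2) => q1 q2; lra.
  have {q} : (#|G|%:R - 2 / mu * (mu * #|G|%:R) +
      (\sum_v (load N gs v)%:R ^+ 2) / mu ^+ 2) / e1 <= #|G|%:R * e1.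
    have E : #|G|%:R * e1 * e1 = #|G|%:R * e1 ^+ 2 by ring.
    by rewrite ler_pdivrMr // E.
  by move: (_ / e1) => q1; lra.
have s3 : \sum_j `|X j - beta| <= #|G|%:R * e1 + #|G|%:R * e1.
  apply: le_trans (lerD s1 s2); rewrite -big_split; apply: ler_sum => j _ /=.
  exact: ler_distD.
rewrite mulrBr hN opprB addrC subrK.
have -> : 2 * #|H|%:R * e1 * #|G|%:R = #|H|%:R * (#|G|%:R * e1 + #|G|%:R * e1).
  by ring.
by rewrite ler_pM2l.
Qed.

End BalancedTiling.

(** * Colourings and degree sequences *)

Lemma bigminn_attained (I : finType) (P : pred I) (F : I -> nat) (n : nat) :
  (\big[minn/n]_(i | P i) F i < n)%N ->
  exists2 i, P i & F i = \big[minn/n]_(i | P i) F i.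
Proof.
pose K m := (m < n)%N -> exists2 i, P i & F i = m.
apply: (big_ind K) => [|a b Ka Kb|i Pi _]; first by rewrite /K ltnn.
  by rewrite /minn; case: (a < b)%N.
by exists i.
Qed.

Section Colourings.
Variable H : sgraph.

Lemma chromatic_number_colourable : colourable H (chromatic_number H).
Proof. by rewrite /chromatic_number; case: ex_minnP. Qed.

Lemma chromatic_number_min k : colourable H k -> (chromatic_number H <= k)%N.
Proof. by rewrite /chromatic_number; case: ex_minnP => m _; apply. Qed.

Lemma chromatic_number_ge2 (x y : H) : edge x y -> (2 <= chromatic_number H)%N.
Proof.
have /existsP[f /forallP/(_ x)/forallP/(_ y)/implyP fxy] :=
  chromatic_number_colourable.
move=> /fxy; move: (f x) (f y) => a b; move: (chromatic_number H) a b.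
case=> [|[|//]] a b; first by case: a.
by rewrite (ord1 a) (ord1 b).
Qed.

(** An empty class could be dropped, giving a proper colouring with fewer than [chromatic_number H]
    colours. *)
Lemma colour_class_neq0 k (f : {ffun H -> 'I_k}) c :
  proper_colouring f -> (k <= chromatic_number H)%N -> (0 < #|colour_class f c|)%N.
Proof.
case: k f c => [|k] f c fP kH; first by case: c.
rewrite lt0n; apply: contraTneq kH => /cards0_eq c0.
rewrite -ltnNge ltnS; apply: chromatic_number_min.
have fc x : c != f x.
  have : x \notin colour_class f c by rewrite c0 inE.
  by rewrite inE eq_sym.
(* With a single colour, an empty class means that [H] has no vertices, and the colouring without
   colours is vacuous. *)
case: k f c fP c0 fc => [|k] f c fP c0 fc.
  have noH (x : H) : False by have := fc x; rewrite (ord1 c) (ord1 (f x)).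
  apply/existsP; exists [ffun x => False_rect _ (noH x)].
  by apply/forallP => x; case: (noH x).
pose g x := odflt ord0 (unlift c (f x)).
have gK x : lift c (g x) = f x.
  by rewrite /g; have [j -> ->] := unlift_some (fc x).
apply/existsP; exists [ffun x => g x]; apply/forallP => x; apply/forallP => y.
apply/implyP => xy; rewrite !ffunE; apply: contraTneq xy => gxy.
apply/negP => xy; have /implyP/(_ xy)/eqP := forallP (forallP fP x) y.
by rewrite -(gK x) gxy gK.
Qed.

(** The strict inequality excludes the default value of both nested minima. *)
Lemma min_colour_class_attained : (min_colour_class H < #|H|)%N ->
  exists (f : {ffun H -> 'I_(chromatic_number H)}) c,
    proper_colouring f /\ #|colour_class f c| = min_colour_class H.
Proof.
move=> lt; have [f fP fE] := bigminn_attained lt.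
move: lt; rewrite {1}/min_colour_class -fE => lt.
by have [c _ cE] := bigminn_attained lt; exists f, c; split; rewrite ?cE.
Qed.

End Colourings.

Section Degrees.
Variable G : sgraph.

Lemma nth_degree_le (v : G) i :
  (0 < i <= #|[set x : G | (degree x <= degree v)%N]|)%N -> (nth_degree G i <= degree v)%N.
Proof.
case/andP => i0 iv; rewrite /nth_degree.
have cE : count (fun d => (d <= degree v)%N) (degree_sequence G) =
    #|[set x : G | (degree x <= degree v)%N]|.
  rewrite /degree_sequence count_sort count_map -sum1_count big_enum_cond /=.
  by rewrite -sum1_card; apply: eq_bigl => x; rewrite inE.
have i_lt : (i.-1 < count (fun d => (d <= degree v)%N) (degree_sequence G))%N.
  by rewrite cE prednK.
exact: (@Order.POrderTheory.nth_count_le _ nat _ 0%N _ _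
  (sort_sorted leq_total _) i_lt).
Qed.

End Degrees.

(** * From the degree sequence to densities *)

Section DegreeDensity.
Variables (R : realType) (G : sgraph) (h om sg eps : R).
Hypotheses (om_gt0 : 0 < om) (sg_gt0 : 0 < sg) (sg_le_om : sg <= om) (h_gt0 : 0 < h).
Local Notation n := (#|G|%:R : R).
Local Notation nonnbr := (nonnbr_density R (@edge G)).
Local Notation rank := (rank_density R (@edge G)).

(** Let [j] count the vertices of degree at most that of [v]. If [j] lies in the range of the degree
    condition, the condition at [j] is the second alternative. Otherwise the last index of the range
    gives the first one, and rounding [om * n / h] down costs at most [sg / om <= 1 <= eps * n]. *)
Lemma degree_density_bound :
  1 <= eps * n -> h <= om * n ->
  (forall i : nat, (1 <= i)%N -> i%:R <= om * n / h ->
    (1 - (om + sg) / h) * n + sg / om * i%:R <= (nth_degree G i)%:R) ->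
  forall v, nonnbr v <= om / h + eps \/
    nonnbr v + sg / om * rank v <= (om + sg) / h.
Proof.
move=> en hn deg v.
have n0' : (0 < #|G|)%N by apply/card_gt0P; exists v.
have n0 : 0 < n by rewrite ltr0n.
have nonnbrE x : nonnbr x = 1 - (degree x)%:R / n.
  rewrite /nonnbr_density avg_indicator.
  have -> : [set y | ~~ edge x y] = ~: [set y | edge x y].
    by apply/setP => y; rewrite !inE.
  have /(congr1 (fun m => m%:R : R)) := cardsC [set y | edge x y].
  rewrite natrD -/(degree x) => E.
  have -> : #|~: [set y | edge x y]|%:R = n - (degree x)%:R by rewrite -E addrAC subrr add0r.
  by rewrite mulrBl divff // gt_eqF.
have rankE : rank v = #|[set x : G | (degree x <= degree v)%N]|%:R / n.
  rewrite /rank_density avg_indicator; congr (_%:R / _); apply: eq_card => x.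
  by rewrite !inE !nonnbrE lerD2l lerN2 ler_pM2r ?invr_gt0 // ler_nat.
set j := #|_| in rankE.
have j0 : (0 < j)%N by apply/card_gt0P; exists v; rewrite inE.
rewrite nonnbrE rankE.
have [jle|jgt] := leP (j%:R : R) (om * n / h); [right|left].
  have := deg j j0 jle; have : (nth_degree G j)%:R <= (degree v)%:R :> R.
    by rewrite ler_nat nth_degree_le // j0 /=.
  move=> h1 /le_trans/(_ h1) h2.
  have : ((1 - (om + sg) / h) * n + sg / om * j%:R) / n <= (degree v)%:R / n.
    by rewrite ler_pM2r // invr_gt0.
  have -> : ((1 - (om + sg) / h) * n + sg / om * j%:R) / n =
      1 - (om + sg) / h + sg / om * (j%:R / n) by field; rewrite !gt_eqF.
  lra.
pose i := Num.truncn (om * n / h).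
have q0 : 0 <= om * n / h by rewrite divr_ge0 ?mulr_ge0 // ltW.
have /andP[i1 i2] := truncn_itv q0.
have i0 : (1 <= i)%N by rewrite truncn_ge_nat // ler_pdivlMr // mul1r.
have ij : (i <= j)%N by rewrite -(ler_nat R) ltW // (le_lt_trans i1).
have := deg i i0 i1; have : (nth_degree G i)%:R <= (degree v)%:R :> R.
  by rewrite ler_nat nth_degree_le // i0.
move=> h1 /le_trans/(_ h1) h2.
have h3 : sg / om * (om * n / h - 1) <= sg / om * i%:R.
  rewrite ler_pM2l ?divr_gt0 // lerBlDr natr1; exact: ltW.
have h4 : sg / om <= 1 by rewrite ler_pdivrMr // mul1r.
have : n - om * n / h - eps * n <= (degree v)%:R.
  apply: le_trans h2; have -> : (1 - (om + sg) / h) * n = n - om * n / h - sg * n / h.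
    by ring.
  have h5 : sg / om * (om * n / h - 1) = sg * n / h - sg / om.
    by field; rewrite !gt_eqF.
  by move: h3; rewrite h5; lra.
rewrite -(ler_pM2r (_ : 0 < n^-1)) ?invr_gt0 //.
have -> : (n - om * n / h - eps * n) / n = 1 - om / h - eps.
  by field; rewrite !gt_eqF.
lra.
Qed.

End DegreeDensity.

(** * Choice of constants and combination of the steps *)

Theorem theorem8p1 (R : realType) (eta : R) (H : sgraph) (r h : nat)
    (sigma omega : R) :
  0 < eta ->
  (exists x y : H, edge x y) ->
  chromatic_number H = r ->
  #|H| = h ->
  (min_colour_class H)%:R <= sigma ->
  sigma <= h%:R / r%:R ->
  omega = (h%:R - sigma) / (r%:R - 1) ->
  exists n0 : nat, forall (G : sgraph) (n : nat),
    #|G| = n ->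
    (n0 <= n)%N ->
    (forall i : nat, (1 <= i)%N -> i%:R <= omega * n%:R / h%:R ->
      (1 - (omega + sigma) / h%:R) * n%:R + sigma / omega * i%:R
        <= (nth_degree G i)%:R) ->
    exists T : {set {ffun H -> G}},
      is_tiling T /\ #|~: covered T|%:R <= eta * n%:R.
Proof.
move=> eta0 [xH [yH xyH]] Hr Hh min_sg sg_hr omE.
have h_gt0 : (0 < h)%N by rewrite -Hh; apply/card_gt0P; exists xH.
have h0 : 0 < h%:R :> R by rewrite ltr0n.
have r2 : (2 <= r)%N by rewrite -Hr; exact: chromatic_number_ge2 xyH.
have r1 : 1 < r%:R :> R by rewrite ltr1n.
have r0 : 0 < r%:R :> R by apply: lt_trans r1.
(* As [r] is at least 2, [sigma] is below [h]. Hence the smallest class size is below its default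
   value and is attained; that class is non-empty, which makes [sigma] positive. *)
have sg_h : sigma < h%:R.
  apply: le_lt_trans sg_hr _; rewrite ltr_pdivrMr // mulrC ltr_pMl //.
have min_h : (min_colour_class H < #|H|)%N.
  by rewrite Hh -(ltr_nat R); apply: le_lt_trans sg_h.
have [f [c [fP cE]]] := min_colour_class_attained min_h.
have c0 := colour_class_neq0 c fP (leqnn _).
rewrite cE -(ltr_nat R) in c0; have sg0 : 0 < sigma by apply: lt_le_trans min_sg.
rewrite -cE in min_sg; rewrite {c0 cE min_h}.
move: f c fP min_sg; rewrite Hr; case: r r2 {Hr} r1 r0 sg_hr omE => [//|[//|k]] _ r1 r0 sg_hr omE f c fP min_sg.
have k0 : 0 < k.+1%:R :> R by [].
have rE : k.+2%:R - 1 = k.+1%:R :> R by rewrite -natr1 addrK.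
have hE : h%:R = k.+1%:R * omega + sigma.
  by rewrite omE rE; field; rewrite nat1r pnatr_eq0.
have sg_om : sigma <= omega.
  move: sg_hr; rewrite ler_pdivlMr // omE rE ler_pdivlMr // -natr1; lra.
have om0 : 0 < omega by apply: lt_le_trans sg_om.
(* The final loss is [2 * h%:R * e1 * n%:R], that is [eta * n%:R]. *)
pose e1 := eta / (2 * h%:R).
have e10 : 0 < e1 by rewrite divr_gt0 // mulr_gt0.
(* [balanced_blocks] asks for at most [1 / 2]; [e1 ^+ 2 / 2] is half of the allowed relative
   variance of the loads, and the other half is left for [2 / mu]. *)
pose e2 := Num.min (1 / 2) (e1 ^+ 2 / 2).
have e20 : 0 < e2 by rewrite lt_min !divr_gt0 ?exprn_gt0.
have e2_half : e2 <= 1 / 2 by rewrite ge_min lexx.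
have e2_e1 : e2 <= e1 ^+ 2 / 2 by rewrite ge_min lexx orbT.
pose K := (2 * k.+2)%:R * (k.+1%:R * omega + sigma) / sigma.
have K0 : 0 <= K by rewrite /K -hE divr_ge0 ?mulr_ge0 // ltW.
(* Sampling costs [eps] in the weight and [eps * K] in the size of the tiling; both fit into the
   factor [1 + e2]. *)
pose eps := e2 / (2 * (1 + 2 * K)).
have eps0 : 0 < eps by rewrite divr_gt0 // mulr_gt0 // ltr_pwDl // mulr_ge0.
have epsE : eps * (2 * (1 + 2 * K)) = e2.
  by rewrite /eps divfK // gt_eqF // mulr_gt0 // ltr_pwDl // mulr_ge0.
have eps1 : eps <= 1.
  have : 0 <= eps * K by rewrite mulr_ge0 // ltW.
  by move: epsE; lra.
have del_eps : 1 + eps < (1 + e2) * (1 - (2 * k.+2)%:R * eps * (k.+1%:R * omega + sigma) / sigma).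
  have -> : (2 * k.+2)%:R * eps * (k.+1%:R * omega + sigma) / sigma = eps * K.
    by rewrite /K; ring.
  have eK0 : 0 <= eps * K by rewrite mulr_ge0 // ltW.
  have eK : e2 * (eps * K) <= eps * K.
    by apply: ler_piMl => //; apply: le_trans e2_half _; lra.
  by move: epsE e20 eK eK0; clearbody e2 eps K; lra.
pose m := Num.bound (32 / eps ^+ 4).
have m1 : 32 <= m%:R * eps ^+ 4.
  rewrite -ler_pdivrMr ?exprn_gt0 //; apply: ltW; apply: archi_boundP.
  by rewrite divr_ge0 ?exprn_ge0 // ltW.
have m2 : 2 <= m%:R * eps.
  apply: le_trans (_ : m%:R * eps ^+ 4 <= _); first by apply: le_trans m1; rewrite ler_nat.
  rewrite ler_wpM2l // exprS ler_piMr ?exprn_ile1 // ltW //.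
pose cst : R := eps / 4 / #|{: 'I_m.+1 * {set 'I_m.+1}}|%:R.
have cst0 : 0 < cst.
  apply: divr_gt0; first exact: divr_gt0.
  by rewrite ltr0n; apply/card_gt0P; exists (ord0, set0).
(* A mean load above [mu0] makes [2 / mu] at most [e1 ^+ 2 / 2], and [t] is chosen to tolerate any
   mean load up to [mu0 + 1]. *)
pose mu0 := 4 / e1 ^+ 2.
have mu00 : 0 < mu0 by rewrite divr_gt0 // exprn_gt0.
pose t := (Num.bound ((mu0 + 1) / e1 ^+ 2)).+1.
have t0 : 0 < t%:R :> R by [].
have t1 : mu0 + 1 <= t%:R * e1 ^+ 2.
  rewrite -ler_pdivrMr ?exprn_gt0 //; apply: ltW.
  apply: lt_trans (_ : (Num.bound ((mu0 + 1) / e1 ^+ 2))%:R < _); last by rewrite ltr_nat.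
  by apply: archi_boundP; rewrite divr_ge0 ?exprn_ge0 ?addr_ge0 // ltW.
have ht0 : (0 < h * t)%N by rewrite muln_gt0 h_gt0.
have [n1 hn1] := dense_contains_blowup m.+1 (h * t) cst0.
(* [n2] bounds the rounding error in the degree condition by [eps * n], and [n3] makes its range of
   indices non-empty. *)
pose n2 := Num.bound (eps^-1); pose n3 := Num.bound (h%:R / omega).
exists (maxn (maxn n1 (h * t)) (maxn n2 n3)) => G n Gn.
rewrite !geq_max -andbA => /and4P[n1n htn n2n n3n] deg.
have n_gt0 : (0 < n)%N by apply: leq_trans htn.
have n0 : 0 < n%:R :> R by rewrite ltr0n.
have en : 1 <= eps * #|G|%:R.
  rewrite Gn mulrC -ler_pdivrMr // div1r ltW //; apply: lt_le_trans (_ : n2%:R <= _).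
    by apply: archi_boundP; rewrite invr_ge0 ltW.
  by rewrite ler_nat.
have hn : h%:R <= omega * #|G|%:R.
  rewrite Gn mulrC -ler_pdivrMr // ltW //; apply: lt_le_trans (_ : n3%:R <= _).
    by apply: archi_boundP; rewrite divr_ge0 // ltW.
  by rewrite ler_nat.
rewrite -Gn in deg.
have dens := degree_density_bound om0 sg0 sg_om h0 en hn deg.
have G0 : (0 < #|G|)%N by rewrite Gn.
have /card_gt0P[v0 _] := G0.
pose Pr (g : H * 'I_t -> G) := forall x y a b, edge x y -> edge (g (x, a)) (g (y, b)).
have light w : (forall v, 0 <= w v) -> 0 < avg w ->
    exists g, [/\ Pr g, injective g &
      \sum_z w (g z) <= (1 + e2) * #|{: H * 'I_t}|%:R * avg w].
  move=> w0 aw0; rewrite hE in dens.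
  have [T Tdens] := light_bottle_density v0 (@edge_sym G) (@edge_irrefl G) sg0 sg_om
    eps0 eps1 del_eps e20 dens m2 m1 w0 aw0.
  have [|Ys [sY uY YP]] := hn1 G _ _ Tdens; first by rewrite Gn.
  have [P [W [Psz Pe PW Wb]]] := blowup_parts (@edge_sym G) (@edge_irrefl G) ht0 sY uY YP.
  have [||||g [gi ge gw]] := light_block (t := t) (eH := @edge H) (col := f) (w := w)
     v0 (@edge_irrefl G) (@edge_irrefl H) _ sg_om _ _ _ Pe PW Wb.
  - move=> x y; exact: (implyP (forallP (forallP fP x) y)).
  - by exists c.
  - by rewrite Hh hE.
  - by rewrite Hh.
  exists g; split=> //; apply: le_trans gw _.
  rewrite card_prod card_ord Hh natrM hE le_eqVlt; apply/orP; left; apply/eqP; ring.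
(* With [q] blocks the mean load would be [mu0]. One block adds at most one to the mean because
   [h * t <= n], so [N'.+1] blocks give a mean between [mu0] and [mu0 + 1]. *)
pose q := mu0 * n%:R / (h * t)%:R.
have ht0' : 0 < (h * t)%:R :> R by rewrite ltr0n.
have q0 : 0 <= q by apply: divr_ge0; [apply: mulr_ge0; exact: ltW|].
have /andP[q1 q2] := truncn_itv q0; set N' := Num.truncn q in q1 q2.
have [gs gsP gs2] := balanced_blocks (ltW e20) e2_half G0 light N'.+1.
pose mu : R := (#|H| * t * N'.+1)%:R / #|G|%:R.
have muE : mu = N'.+1%:R * ((h * t)%:R / n%:R) by rewrite /mu Hh Gn natrM; ring.
have mu_lb : mu0 < mu.
  rewrite muE; move: q2; rewrite /q ltr_pdivrMr // => q2.
  by rewrite mulrA ltr_pdivlMr.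
have mu_ub : mu <= mu0 + 1.
  rewrite muE -natr1 mulrDl mul1r lerD //.
    rewrite mulrA ler_pdivrMr //; move: q1; rewrite /q ler_pdivlMr //.
  by rewrite ler_pdivrMr // mul1r ler_nat.
have mu_gt0 : 0 < mu by apply: lt_trans mu_lb.
have [||||T [Ttil Tcov]] := @tiling_of_balanced_blocks R H G N'.+1 t gs e1 e2 mu
    _ G0 isT isT e10 gsP erefl.
- by rewrite Hh.
- apply: le_trans gs2 _; rewrite card_prod card_ord.
  have -> : (#|H| * t * N'.+1)%:R = mu * #|G|%:R :> R.
    by rewrite /mu divfK // pnatr_eq0 -lt0n.
  rewrite le_eqVlt; apply/orP; left; apply/eqP; field.
  by rewrite pnatr_eq0 -lt0n.
- exact: le_trans mu_ub t1.
- have : 2 / mu <= e1 ^+ 2 / 2.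
    rewrite ler_pdivrMr //; apply: le_trans (_ : e1 ^+ 2 / 2 * mu0 <= _).
      by rewrite /mu0 le_eqVlt; apply/orP; left; apply/eqP; field; rewrite gt_eqF.
    by rewrite ler_pM2l ?divr_gt0 ?exprn_gt0 // ltW.
  by move: e2_e1; lra.
exists T; split=> //; apply: le_trans Tcov _; rewrite Gn Hh /e1.
by rewrite le_eqVlt; apply/orP; left; apply/eqP; field; rewrite gt_eqF.
Qed.
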